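(* Let $s>0$ be real and $\Lambda\subseteq\mathbb{R}^n$ a lattice. Then $$\sum_{x\in\Lambda}\prod_{i=1}^n \frac{1}{1+ s x_i^2}= \frac{1}{\operatorname{vol}(\Lambda)}\left(\frac{\pi}{\sqrt{s}}\right)^{n}\Theta_{\Lambda^*}^1 \left(e^{-\frac{2\pi}{\sqrt{s}}}\right),$$ where $\Theta_{\Lambda^*}^1$ is the theta function of the dual lattice $\Lambda^*$ in the $\ell^1$-norm.
   Context: A lattice $\Lambda\subseteq\mathbb{R}^n$ is the $\mathbb{Z}$-span of a basis of $\mathbb{R}^n$; $\operatorname{vol}(\Lambda)=|\det B|$ for any generator matrix $B$; $\Lambda^*=\{y\in\mathbb{R}^n:x\cdot y\in\mathbb{Z}\text{ for all }x\in\Lambda\}$. For a lattice $L$, $\Theta^1_L(q)=\sum_{x\in L}q^{\|x\|_1}$ for real $0\le q<1$, where $\|x\|_1=\sum_i|x_i|$. *)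

(* Defs.v *)
(* R^n is the space 'rV[R]_n of row vectors. *)
From mathcomp Require Import all_boot all_order all_algebra.
From mathcomp Require Import all_classical all_reals all_analysis.

Set Implicit Arguments.
Unset Strict Implicit.
Unset Printing Implicit Defensive.

Import Order.TTheory GRing.Theory Num.Theory.
Local Open Scope classical_set_scope.
Local Open Scope ring_scope.

(* The basis vectors are the rows of B. *)
Definition generator_matrix (R : realType) (n : nat) (B : 'M[R]_n)
    (L : set 'rV[R]_n) : Prop :=
  B \in unitmx /\ L = range (fun z : 'rV[int]_n => map_mx intr z *m B).

Definition is_lattice (R : realType) (n : nat) (L : set 'rV[R]_n) : Prop :=
  exists B : 'M[R]_n, generator_matrix B L.

(* The choice of a generator matrix is immaterial, see [volE]; the value on a
   set that is not a lattice is junk. *)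
Definition vol (R : realType) (n : nat) (L : set 'rV[R]_n) : R :=
  `|\det (xget 0 [set B : 'M[R]_n | generator_matrix B L])|.

Definition dual (R : realType) (n : nat) (L : set 'rV[R]_n) : set 'rV[R]_n :=
  [set y | forall x, L x -> \sum_(i < n) x 0 i * y 0 i \is a Num.int].

Definition l1norm (R : realType) (n : nat) (x : 'rV[R]_n) : R :=
  \sum_(i < n) `|x 0 i|.

(* An unconditional sum of nonnegative terms, hence valued in \bar R.
   [powR] satisfies 0 `^ 0 = 1 and 0 `^ t = 0 for t != 0, so that the value
   at q = 0 is 1 for a lattice. *)
Definition theta1 (R : realType) (n : nat) (L : set 'rV[R]_n) (q : R) : \bar R :=
  (\esum_(x in L) (q `^ l1norm x)%:E)%E.

Lemma generator_matrix_change (R : realType) (n : nat) (L : set 'rV[R]_n)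
    (B C : 'M[R]_n) : generator_matrix B L -> generator_matrix C L ->
  exists U : 'M[int]_n, B = map_mx intr U *m C.
Proof.
move=> [_ LB] [_ LC].
have rowB i : exists z : 'rV[int]_n, map_mx intr z *m C = row i B.
  have : L (row i B).
    rewrite LB; exists (delta_mx 0 i) => //.
    by rewrite map_delta_mx rowE.
  by rewrite LC => -[z _ zE]; exists z.
have [f fE] := choice rowB.
exists (\matrix_i f i); apply/row_matrixP => i.
by rewrite row_mul -map_row rowK fE.
Qed.

Lemma volE (R : realType) (n : nat) (L : set 'rV[R]_n) (B : 'M[R]_n) :
  generator_matrix B L -> vol L = `|\det B|.
Proof.
move=> gB; rewrite /vol; set C := xget _ _.
have gC : generator_matrix C L.
  exact: (@xgetI _ 0 [set B : 'M[R]_n | generator_matrix B L] B gB).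
have detB0 : \det B != 0 by case: gB; rewrite unitmxE unitfE.
have detC0 : \det C != 0 by case: gC; rewrite unitmxE unitfE.
have le_det (M N : 'M[R]_n) : generator_matrix M L -> generator_matrix N L ->
    \det M != 0 -> `|\det N| <= `|\det M|.
  move=> gM gN detM0.
  have [U ME] := generator_matrix_change gM gN.
  move: detM0; rewrite ME det_mulmx det_map_mx mulf_eq0 negb_or intr_eq0.
  move=> /andP[detU0 _].
  rewrite normrM ler_peMl// -intr_norm ler1z.
  by rewrite -gtz0_ge1 normr_gt0.
by apply/eqP; rewrite eq_le !le_det.
Qed.

(* Main.v *)
Require Import Defs.
From mathcomp Require Import all_boot all_order all_algebra.
From mathcomp Require Import complex.
From mathcomp Require Import all_classical all_reals all_analysis.
From mathcomp Require Import ring lra zify.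

(* The summand and exp (- 2 pi c |t|_1) are Fourier transforms of each other,
   and both are products over the coordinates.  If the dual lattice is an
   integer lattice M of full rank, expand the indicator function of M in Z^n by
   the characters of the finite group Z^n / M: the sum of r ^ |k|_1 over M
   becomes a finite sum of products of Poisson kernels
   sum_k r ^ |k| cos (2 pi k x) = (1 - r^2) / (1 - 2 r cos (2 pi x) + r^2), and
   each kernel with r = exp (- 2 pi c) is, up to the factor pi / c, the periodic
   sum of 1 / (c^2 + (x + j)^2), which follows by iterating its duplication
   formula.  Smith normal form makes the characters explicit.  Scaling gives
   rational lattices, and an arbitrary lattice is a limit of rational ones; no
   mass escapes to infinity because rounding the points of a lattice to a fine
   grid is injective, uniformly along the approximation. *)

Set Implicit Arguments.
Unset Strict Implicit.

Import Order.TTheory GRing.Theory Num.Theory.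
Import numFieldNormedType.Exports.
Local Open Scope classical_set_scope.
Local Open Scope ring_scope.

(** * Unconditional sums and limits *)

Section Esum.
Variable R : realType.

(** The two sides meet in one finite sum. The dual of an integer lattice contains Z^n, and the
    representatives of its finitely many cosets are exactly the points at which the character
    expansion evaluates the Poisson kernels; summing the partial fractions over each coset therefore
    produces that same finite sum. The delicate step is the limit over lattices. The product of the
    1 / (1 + x_i^2) decays unevenly, only quadratically along the axes, and a small change of basis
    moves remote lattice points far across the coordinate hyperplanes, so no fixed majorant on the
    index set Z^n is at hand. The majorant is instead composed with an index map that depends on the
    approximation. Finite partial sums always pass to the limit; tightness of one side then gives
    one inequality between the limit sums, and tightness of both sides gives equality. *)

Lemma esumT_le (T : choiceType) (f : T -> R) (M : R) :
  (forall s : seq T, uniq s -> \sum_(x <- s) f x <= M) ->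
  (\esum_(x in [set: T]) (f x)%:E <= M%:E)%E.
Proof.
move=> fM; apply: ge_ereal_sup => _ /= [X [finX _]] <-.
by rewrite fsbig_finite//= sumEFin lee_fin fM.
Qed.

Lemma esumT_ge (T : choiceType) (f : T -> R) (s : seq T) : uniq s ->
  ((\sum_(x <- s) f x)%:E <= \esum_(x in [set: T]) (f x)%:E)%E.
Proof.
move=> us; apply: esum_ge; exists [set` s]; first by split.
by rewrite -sumEFin fsbig_seq//.
Qed.

Lemma esumT_approx (T : choiceType) (f : T -> R) (e : R) :
  (\esum_(x in [set: T]) (f x)%:E < +oo)%E -> 0 < e ->
  exists2 s : seq T, uniq s &
    (\esum_(x in [set: T]) (f x)%:E <= (\sum_(x <- s) f x + e)%:E)%E.
Proof.
move=> foo e0; set S := (\esum_(x in _) _)%E.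
have S0 : (0%:E <= S)%E by have := @esumT_ge T f [::] isT; rewrite big_nil.
have Sfin : S \is a fin_num by rewrite ge0_fin_numE.
have : (S - e%:E < S)%E by rewrite lteBlDr// lteDl// lte_fin.
move=> /ereal_sup_gt[_ [X [finX _] <-]].
rewrite fsbig_finite//= sumEFin => lt.
exists (finmap.enum_fset (fset_set X)); first exact: finmap.fset_uniq.
by rewrite EFinD -leeBlDr// ltW.
Qed.

Lemma le_sum_uniq_sub (T : choiceType) (f : T -> R) (s t : seq T) :
  (forall x, 0 <= f x) -> uniq s -> uniq t -> {subset s <= t} ->
  \sum_(x <- s) f x <= \sum_(x <- t) f x.
Proof.
move=> f0 us ut st; rewrite [leRHS](bigID (mem s))/=.
have -> : \sum_(x <- s) f x = \sum_(x <- t | x \in s) f x.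
  rewrite -[RHS]big_filter; apply/perm_big/uniq_perm => //.
    exact: filter_uniq.
  move=> x; rewrite mem_filter; apply/idP/idP => [xs|/andP[]//].
  by apply/andP; split => //; exact: st.
by rewrite lerDl sumr_ge0.
Qed.

(** Uniformly small tails. The bound avoids a subtraction in [\bar R], and it makes the sums finite
    for all large [N]. *)
Definition tight (T : choiceType) (b : nat -> T -> R) :=
  forall e : R, 0 < e -> exists2 s : seq T, uniq s &
    \forall N \near \oo,
      (\esum_(x in [set: T]) (b N x)%:E <= (\sum_(x <- s) b N x + e)%:E)%E.

Lemma cvg_sum_seq (T : Type) (s : seq T) (f : nat -> T -> R) (g : T -> R) :
  (forall x, (fun N => f N x) @ \oo --> g x) ->
  (fun N => \sum_(x <- s) f N x) @ \oo --> \sum_(x <- s) g x.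
Proof.
move=> fg; elim: s => [|x s IH].
  by under eq_fun do rewrite big_nil; rewrite big_nil; exact: cvg_cst.
by under eq_fun do rewrite big_cons; rewrite big_cons; apply: cvgD.
Qed.

Lemma cvg_prod_seq (T : Type) (s : seq T) (f : nat -> T -> R) (g : T -> R) :
  (forall x, (fun N => f N x) @ \oo --> g x) ->
  (fun N => \prod_(x <- s) f N x) @ \oo --> \prod_(x <- s) g x.
Proof.
move=> fg; elim: s => [|x s IH].
  by under eq_fun do rewrite big_nil; rewrite big_nil; exact: cvg_cst.
by under eq_fun do rewrite big_cons; rewrite big_cons; apply: cvgM.
Qed.

(** A finite partial sum of [a'] is a limit of partial sums of [a N], which the total of [b N]
    bounds; tightness replaces that total by a finite partial sum plus [e], which has a limit
    again. *)
Lemma esum_cvg_le (T T' : choiceType) (a : nat -> T -> R) (a' : T -> R)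
    (b : nat -> T' -> R) (b' : T' -> R) :
  (forall x, (fun N => a N x) @ \oo --> a' x) ->
  (forall x, (fun N => b N x) @ \oo --> b' x) ->
  tight b ->
  (\forall N \near \oo, (\esum_(x in [set: T]) (a N x)%:E <=
                         \esum_(x in [set: T']) (b N x)%:E)%E) ->
  (\esum_(x in [set: T]) (a' x)%:E <= \esum_(x in [set: T']) (b' x)%:E)%E.
Proof.
move=> aa' bb' tb leab; apply/lee_addgt0Pr => e e0.
have [s us sb] := tb _ e0.
apply: (@le_trans _ _ (\sum_(x <- s) b' x + e)%:E%E); last first.
  by rewrite EFinD leeD// esumT_ge.
apply: esumT_le => t ut.
have ca := @cvg_sum_seq _ t _ _ aa'.
have cb : (fun N => \sum_(x <- s) b N x + e) @ \oo --> \sum_(x <- s) b' x + e.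
  by apply: cvgD; [exact: cvg_sum_seq|exact: cvg_cst].
apply: (ler_cvg_to ca cb); near=> N.
rewrite -lee_fin (le_trans (esumT_ge _ ut))//.
apply: (le_trans (near leab N _)) => //; exact: (near sb N).
Unshelve. all: by end_near.
Qed.

(** Domination along injections [i N] that vary with [N]. Points outside [s] have distinct images
    outside [t], so their terms add up to at most [K] times the tail of [h] beyond [t]. The last
    hypothesis keeps [s] the same for all large [N]. *)
Lemma tight_dominated (T T' : choiceType) (b : nat -> T -> R) (h : T' -> R)
    (i : nat -> T -> T') (K : R) :
  (forall x, 0 <= h x) -> (\esum_(x in [set: T']) (h x)%:E < +oo)%E -> 0 <= K ->
  (\forall N \near \oo, injective (i N)) ->
  (\forall N \near \oo, forall x, 0 <= b N x <= K * h (i N x)) ->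
  (forall t : seq T', exists s : seq T,
    \forall N \near \oo, forall x, i N x \in t -> x \in s) ->
  tight b.
Proof.
move=> h0 hoo K0 inji bh fini e e0.
(* The denominator is [K + 1] because [K] may be 0. *)
have e1 : 0 < e / (K + 1) by rewrite divr_gt0// ltr_wpDl.
have [t ut ht] := esumT_approx hoo e1.
have [s' hs'] := fini t.
pose s := undup s'; have us : uniq s by exact: undup_uniq.
exists s => //; near=> N.
have injN : injective (i N) by exact: (near inji N).
have bN : forall x, 0 <= b N x <= K * h (i N x) by near: N.
have tN : forall x, i N x \in t -> x \in s.
  by move=> x; rewrite mem_undup; move: x; near: N.
apply: esumT_le => u uu.
rewrite (bigID (mem s))/=; apply: lerD.
  rewrite -big_filter; apply: le_sum_uniq_sub => //.
  - by move=> x; have /andP[] := bN x.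
  - exact: filter_uniq.
  - by move=> x; rewrite mem_filter => /andP[].
rewrite -big_filter; set v := (X in \sum_(_ <- X) _ <= _).
apply: (@le_trans _ _ (K * \sum_(y <- map (i N) v) h y)).
  by rewrite big_map mulr_sumr; apply: ler_sum => x _; have /andP[] := bN x.
have : \sum_(y <- map (i N) v) h y <= e / (K + 1).
  have uv : uniq (t ++ map (i N) v).
    rewrite cat_uniq ut map_inj_uniq// filter_uniq// andbT/=.
    apply/hasPn => _ /mapP[x + ->]; rewrite mem_filter => /andP[+ _].
    by apply: contra => /tN.
  have := le_trans (esumT_ge h uv) ht.
  by rewrite lee_fin big_cat/= lerD2l.
move=> /(ler_wpM2l K0) /le_trans; apply.
rewrite mulrCA ger_pMr// ler_pdivrMr; last by rewrite ltr_wpDl.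
by rewrite mul1r lerDl.
Unshelve. all: by end_near.
Qed.

Lemma esum_finite_support (T : choiceType) (f : T -> R) (s : seq T) :
  uniq s -> (forall x, 0 <= f x) -> (forall x, x \notin s -> f x = 0) ->
  (\esum_(x in [set: T]) (f x)%:E)%E = (\sum_(x <- s) f x)%:E.
Proof.
move=> us f0 fs; apply/le_anti; rewrite esumT_ge// andbT.
apply: esumT_le => u uu; rewrite (bigID (mem s))/= [X in _ + X]big1 ?addr0//.
rewrite -big_filter; apply: le_sum_uniq_sub => //; first exact: filter_uniq.
by move=> x; rewrite mem_filter => /andP[].
Qed.

Lemma esum_cvg_bounded (T : choiceType) (a : nat -> T -> R) (a' : T -> R) (M : R) :
  (forall x, (fun N => a N x) @ \oo --> a' x) ->
  (\forall N \near \oo, (\esum_(x in [set: T]) (a N x)%:E <= M%:E)%E) ->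
  (\esum_(x in [set: T]) (a' x)%:E <= M%:E)%E.
Proof.
move=> aa' aM; apply: esumT_le => s us.
apply: (cvgr_to_le (@cvg_sum_seq _ s _ _ aa')); near=> N.
by rewrite -lee_fin (le_trans (esumT_ge _ us))//; near: N.
Unshelve. all: by end_near.
Qed.

Lemma esum_cvg_ge (T : choiceType) (b : nat -> T -> R) (b' : T -> R) (M : R) :
  (forall x, (fun N => b N x) @ \oo --> b' x) -> tight b ->
  (\forall N \near \oo, (M%:E <= \esum_(x in [set: T]) (b N x)%:E)%E) ->
  (M%:E <= \esum_(x in [set: T]) (b' x)%:E)%E.
Proof.
move=> bb' tb Mb; apply/lee_addgt0Pr => e e0.
have [s us sb] := tb _ e0.
apply: (@le_trans _ _ (\sum_(x <- s) b' x + e)%:E%E); last first.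
  by rewrite EFinD leeD// esumT_ge.
have cb : (fun N => \sum_(x <- s) b N x + e) @ \oo --> \sum_(x <- s) b' x + e.
  by apply: cvgD; [exact: cvg_sum_seq|exact: cvg_cst].
rewrite lee_fin; apply: (cvgr_to_ge cb); near=> N.
rewrite -lee_fin; apply: le_trans (near sb N _) => //; exact: (near Mb N).
Unshelve. all: by end_near.
Qed.

Lemma esumZl (T : choiceType) (k : R) (f : T -> R) : 0 < k ->
  (\esum_(x in [set: T]) (k * f x)%:E = k%:E * \esum_(x in [set: T]) (f x)%:E)%E.
Proof.
have le (c : R) (g : T -> R) : 0 < c ->
    (\esum_(x in [set: T]) (c * g x)%:E <= c%:E * \esum_(x in [set: T]) (g x)%:E)%E.
  move=> c0; apply: ge_ereal_sup => _ /= [X [finX _] <-].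
  rewrite fsbig_finite//= sumEFin -mulr_sumr EFinM lee_pmul2l//.
  exact: esumT_ge (finmap.fset_uniq _).
move=> k0; apply/le_anti; rewrite le//=.
(* The same inequality for the factor [k^-1] is the converse one. *)
have kV0 : 0 < k^-1 by rewrite invr_gt0.
have := le k^-1 (fun x => k * f x) kV0.
rewrite (eq_esum (b := fun x => (f x)%:E)); last first.
  by move=> x _; rewrite mulKf// gt_eqF.
rewrite -(@lee_pmul2l _ k%:E)// muleA -EFinM divff ?gt_eqF// mul1e.
exact.
Qed.

End Esum.

(** * Unconditional sums as limits over growing boxes *)

Section Exhaustion.
Variable R : realType.

(** No nesting is imposed: lists that eventually contain each point eventually contain each finite
    set. *)
Definition exhausting (T : eqType) (e : nat -> seq T) :=
  (forall K, uniq (e K)) /\ (forall x, \forall K \near \oo, x \in e K).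

Lemma exhausting_sub (T : eqType) (e : nat -> seq T) (s : seq T) :
  exhausting e -> \forall K \near \oo, {subset s <= e K}.
Proof.
move=> [_ ee]; elim: s => [|x s IH]; first by apply: nearW.
near=> K => y; rewrite inE => /predU1P[->|ys].
  by near: K; exact: ee.
have sK : {subset s <= e K} by near: K.
exact: sK.
Unshelve. all: by end_near.
Qed.

Lemma esum_exhausting (T : choiceType) (e : nat -> seq T) (f : T -> R) (l : R) :
  exhausting e -> (forall x, 0 <= f x) ->
  (fun K => \sum_(x <- e K) f x) @ \oo --> l ->
  (\esum_(x in [set: T]) (f x)%:E)%E = l%:E.
Proof.
move=> ee f0 fl; have [ue _] := ee.
apply/le_anti/andP; split.
  apply: esumT_le => s us; apply: (cvgr_to_ge fl); near=> K.
  apply: le_sum_uniq_sub => //; near: K; exact: exhausting_sub.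
have : forall K, ((\sum_(x <- e K) f x)%:E <= \esum_(x in [set: T]) (f x)%:E)%E.
  by move=> K; exact: esumT_ge.
case: (\esum_(x in _) _)%E => [r| |] le; last 2 first.
- by rewrite leey.
- by have := le 0%N.
by rewrite lee_fin; apply: (cvgr_to_le fl); apply: nearW => K; rewrite -lee_fin.
Unshelve. all: by end_near.
Qed.

Lemma cvg_exhausting (T : choiceType) (e : nat -> seq T) (f : T -> R) (l : R) :
  exhausting e -> (forall x, 0 <= f x) ->
  (\esum_(x in [set: T]) (f x)%:E)%E = l%:E ->
  (fun K => \sum_(x <- e K) f x) @ \oo --> l.
Proof.
move=> ee f0 fl; have [ue _] := ee.
apply/cvgrPdist_le => eps eps0.
have foo : (\esum_(x in [set: T]) (f x)%:E < +oo)%E by rewrite fl ltry.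
have [s us] := esumT_approx foo eps0; rewrite fl lee_fin => ls.
near=> K.
have sK : {subset s <= e K} by near: K; exact: exhausting_sub.
have := le_sum_uniq_sub f0 us (ue K) sK.
have := esumT_ge f (ue K); rewrite fl lee_fin => h1 h2.
by rewrite ger0_norm ?subr_ge0// lerBlDr (le_trans ls)// addrC lerD2l.
Unshelve. all: by end_near.
Qed.

Definition int_box (K : nat) (i : 'I_K.*2.+1) : int := i%:Z - K%:Z.

Lemma int_box_inj K : injective (@int_box K).
Proof. by move=> i j; rewrite /int_box => /addIr[] /ord_inj. Qed.

Lemma int_boxP (K : nat) (j : int) :
  reflect (exists i : 'I_K.*2.+1, j = int_box i) (`|j| <= K)%N.
Proof.
apply: (iffP idP) => [jK|[i ->]]; last by rewrite /int_box; have := ltn_ord i; lia.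
have h : (absz (j + K%:Z)%R < K.*2.+1)%N by lia.
by exists (Ordinal h); rewrite /int_box/=; lia.
Qed.

(** Indexing the box [-K, K]^n by finite functions lets [bigA_distr_bigA] turn a sum of products
    over it into a product of sums. *)
Definition row_box n (K : nat) (t : {ffun 'I_n -> 'I_K.*2.+1}) : 'rV[int]_n :=
  \row_i int_box (t i).

Lemma exhausting_int :
  exhausting (fun K => [seq int_box i | i <- enum 'I_K.*2.+1]).
Proof.
split=> [K|j]; first by rewrite map_inj_uniq ?enum_uniq//; exact: int_box_inj.
exists `|j|%N => // K /= jK.
have /int_boxP[i ->] : (`|j| <= K)%N by [].
by rewrite map_f// mem_enum.
Qed.

Lemma mem_row_box n K (z : 'rV[int]_n) : (forall i, `|z 0%R i| <= K)%N ->
  z \in [seq row_box t | t <- enum {ffun 'I_n -> 'I_K.*2.+1}].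
Proof.
move=> zK.
have h (i : 'I_n) : exists k : 'I_K.*2.+1, z 0 i = int_box k.
  exact/int_boxP.
have [f fE] := choice h.
apply/mapP; exists [ffun i => f i]; first by rewrite mem_enum.
by apply/rowP => i; rewrite !mxE ffunE.
Qed.

Lemma exhausting_row n :
  exhausting (fun K => [seq row_box t | t <- enum {ffun 'I_n -> 'I_K.*2.+1}]).
Proof.
split=> [K|z].
  rewrite map_inj_uniq ?enum_uniq// => t u /rowP tu; apply/ffunP => i.
  by have := tu i; rewrite !mxE => /int_box_inj.
exists (\max_i `|z 0%R i|)%N => // K /= zK; apply: mem_row_box => i.
by apply: leq_trans zK; exact: leq_bigmax.
Qed.

Lemma esum_int (g : int -> R) (l : R) : (forall j, 0 <= g j) ->
  (\esum_(j in [set: int]) (g j)%:E)%E = l%:E <->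
  (fun K => \sum_(i < K.*2.+1) g (int_box i)) @ \oo --> l.
Proof.
move=> g0.
have E K : \sum_(i < K.*2.+1) g (int_box i) =
    \sum_(j <- [seq int_box i | i <- enum 'I_K.*2.+1]) g j.
  by rewrite big_map big_enum.
rewrite (funext E).
by split; [apply: cvg_exhausting|apply: esum_exhausting] => //;
  exact: exhausting_int.
Qed.

Lemma esum_row n (g : 'rV[int]_n -> R) (l : R) : (forall j, 0 <= g j) ->
  (\esum_(j in [set: 'rV_n]) (g j)%:E)%E = l%:E <->
  (fun K => \sum_(t : {ffun 'I_n -> 'I_K.*2.+1}) g (row_box t)) @ \oo --> l.
Proof.
move=> g0.
have E K : \sum_(t : {ffun 'I_n -> 'I_K.*2.+1}) g (row_box t) =
    \sum_(z <- [seq row_box t | t <- enum {ffun 'I_n -> 'I_K.*2.+1}]) g z.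
  by rewrite big_map big_enum.
rewrite (funext E).
by split; [apply: cvg_exhausting|apply: esum_exhausting] => //;
  exact: exhausting_row.
Qed.

(** Over each box the sum of products factors exactly, and each of the finitely many factors
    converges. *)
Lemma esum_row_prod n (g : 'I_n -> int -> R) (l : 'I_n -> R) :
  (forall i j, 0 <= g i j) ->
  (forall i, (\esum_(j in [set: int]) (g i j)%:E)%E = (l i)%:E) ->
  (\esum_(z in [set: 'rV[int]_n]) (\prod_i g i (z 0 i))%:E)%E =
  (\prod_i l i)%:E.
Proof.
move=> g0 gl; apply/esum_row; first by move=> z; exact: prodr_ge0.
have E K : \sum_(t : {ffun 'I_n -> 'I_K.*2.+1}) \prod_i g i (row_box t 0 i) =
   \prod_i \sum_(k < K.*2.+1) g i (int_box k).
  by rewrite bigA_distr_bigA; do 2 (apply: eq_bigr => ? _); rewrite mxE.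
under eq_fun do rewrite E.
by apply: cvg_prod_seq => i; apply/esum_int.
Qed.

End Exhaustion.

(** * Poisson kernels and partial fractions *)

Section PartialFractions.
Variable R : realType.
Implicit Types (q x c : R).

Definition poisson_kernel q x : R :=
  (1 - q ^+ 2) / (1 - 2 * q * cos (2 * pi * x) + q ^+ 2).

Lemma poisson_denom_gt0 q x : 0 <= q < 1 ->
  0 < 1 - 2 * q * cos (2 * pi * x) + q ^+ 2.
Proof.
move=> /andP[q0 q1]; apply: (@lt_le_trans _ _ ((1 - q) ^+ 2)).
  by rewrite exprn_gt0// subr_gt0.
have := cos_le1 (2 * pi * x); nra.
Qed.

Lemma poisson_kernel_ge0 q x : 0 <= q < 1 -> 0 <= poisson_kernel q x.
Proof.
move=> q01; rewrite divr_ge0// ?ltW ?poisson_denom_gt0//.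
by case/andP: q01 => q0 q1; nra.
Qed.

Lemma cosD2piM (t : R) (m : nat) : cos (t + 2 * pi * m%:R) = cos t.
Proof.
rewrite (_ : 2 * pi * m%:R = pi *+ 2 *+ m); last first.
  by rewrite -[RHS]mulr_natr -(mulr_natl pi).
exact: (periodicn (@cosD2pi R)).
Qed.

Lemma cosD2piMz (t : R) (m : int) : cos (t + 2 * pi * m%:~R) = cos t.
Proof.
case: m => m; first exact: cosD2piM.
by rewrite NegzE mulrNz mulrN -(cosD2piM _ m.+1) subrK.
Qed.

Lemma poisson_kernelDz q x (m : int) :
  poisson_kernel q (x + m%:~R) = poisson_kernel q x.
Proof. by rewrite /poisson_kernel mulrDr cosD2piMz. Qed.

(** Averaging over a half-period shift kills the odd Fourier coefficients. Algebraically, with C =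
    cos (2 pi x), the denominators at C and -C multiply to the one of [q ^+ 2] at 2 C^2 - 1. *)
Lemma poisson_kernel_double q x : 0 <= q < 1 ->
  poisson_kernel q x + poisson_kernel q (x + 2^-1) =
  2 * poisson_kernel (q ^+ 2) (2 * x).
Proof.
move=> q01; have /andP[q0 q1] := q01.
have q201 : 0 <= q ^+ 2 < 1 by rewrite exprn_ge0//= expr_lt1.
have d1 := poisson_denom_gt0 x q01.
have d2 := poisson_denom_gt0 (x + 2^-1) q01.
have d3 := poisson_denom_gt0 (2 * x) q201.
rewrite /poisson_kernel; move: d1 d2 d3.
have -> : cos (2 * pi * (x + 2^-1)) = - cos (2 * pi * x).
  by rewrite (_ : 2 * pi * (x + 2^-1) = 2 * pi * x + pi) ?cosDpi//; field.
have -> : cos (2 * pi * (2 * x)) = 2 * cos (2 * pi * x) ^+ 2 - 1.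
  rewrite (_ : 2 * pi * (2 * x) = (2 * pi * x) *+ 2); last by ring.
  by rewrite cos_mulr2n -[in LHS]mulr_natl.
move: (cos _) => C d1 d2 d3.
field; rewrite -?exprM; do ?[apply/andP; split]; lra.
Qed.

Lemma poisson_kernel_replicate k q x : 0 <= q < 1 ->
  \sum_(j < 2 ^ k) poisson_kernel q ((x + j%:R) / 2 ^+ k) =
  2 ^+ k * poisson_kernel (q ^+ (2 ^ k)) x.
Proof.
elim: k q => [|k IH] q q01.
  by rewrite expn0 big_ord1 expr0 invr1 mulr1 addr0 mul1r expr1.
have q201 : 0 <= q ^+ 2 < 1.
  by case/andP: q01 => q0 q1; rewrite exprn_ge0//= expr_lt1.
rewrite (_ : 2 ^ k.+1 = 2 ^ k + 2 ^ k)%N; last by rewrite expnS mul2n addnn.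
rewrite big_split_ord/= -big_split/=.
have h0 : 2 ^+ k != 0 :> R by rewrite expf_neq0// pnatr_eq0.
(* The indices [j] and [2 ^ k + j] give points half a period apart. *)
have E (j : 'I_(2 ^ k)) : poisson_kernel q ((x + j%:R) / 2 ^+ k.+1) +
    poisson_kernel q ((x + (2 ^ k + j)%:R) / 2 ^+ k.+1) =
    2 * poisson_kernel (q ^+ 2) ((x + j%:R) / 2 ^+ k).
  have -> : (x + (2 ^ k + j)%:R) / 2 ^+ k.+1 = (x + j%:R) / 2 ^+ k.+1 + 2^-1.
    by rewrite natrD natrX exprS; field.
  by rewrite poisson_kernel_double//; congr (_ * poisson_kernel _ _);
    rewrite exprS; field.
rewrite (eq_bigr _ (fun j _ => E j)) -mulr_sumr IH// -exprM -expnS mulrA.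
by rewrite -exprS expnS mul2n addnn.
Qed.

End PartialFractions.

(** * Termwise limit of the iterated duplication formula *)

Section PartialFractionsLimit.
Variable R : realType.
Implicit Types (q x y c h : R).

(** This form writes the denominator as two nonnegative terms, both of order h^2 when 1 - q and x
    are of order h; the limit and the uniform bound both rest on it. *)
Lemma poisson_kernel_sin q x : poisson_kernel q x =
  (1 - q) * (1 + q) / ((1 - q) ^+ 2 + 4 * q * sin (pi * x) ^+ 2).
Proof.
rewrite /poisson_kernel; congr (_ / _); first by ring.
rewrite (_ : 2 * pi * x = (pi * x) *+ 2); last by ring.
by rewrite cos_mulr2n cos2sin2; ring.
Qed.

Lemma is_derive_eqfun (f g : R -> R) (a v df : R) : f =1 g ->
  is_derive a v f df -> is_derive a v g df.
Proof. by move=> /funext ->. Qed.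

Lemma is_derive_mull (k x : R) : is_derive x (1 : R) (fun t : R => k * t) k.
Proof.
apply: is_derive_eq (is_deriveZ k (is_derive_id x (1 : R))) _.
by rewrite /GRing.scale/= mulr1.
Qed.

Lemma cvg_derive0 (f : R -> R) (df : R) (u : nat -> R) :
  is_derive (0 : R) (1 : R) f df -> f 0 = 0 -> (forall k, u k != 0) ->
  u @ \oo --> 0 ->
  (fun k => f (u k) / u k) @ \oo --> df.
Proof.
move=> fd f0 un0 u0.
have fD : derivable f 0 1 by apply: ex_derive.
have /cvgr_dnbhsP/(_ u (conj un0 u0)) : (fun h : R => h^-1 *:
    ((f \o shift 0) (h *: (1 : R)) - f 0)) @ 0^' --> df.
  by rewrite -(@derive_val _ _ _ _ _ _ _ fd).
apply: cvg_trans; apply: near_eq_cvg; apply: nearW => k.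
by rewrite /= /GRing.scale/= f0 subr0 mulr1 addr0 mulrC.
Qed.

Lemma cvg_half_pow : (fun k => (2 ^+ k.+1)^-1) @ \oo --> (0 : R).
Proof.
have /cvg_expr : `|2^-1 : R| < 1.
  by rewrite ger0_norm ?invr_ge0// invf_lt1// ltr1n.
rewrite -cvg_shiftS; apply: cvg_trans; apply: near_eq_cvg.
by apply: nearW => k; rewrite /= exprVn.
Qed.

(** The value of q is chosen so that q ^ (2 ^ k.+1) = exp (- 2 pi c), and the factor in front so
    that the 2 ^ k.+1 translates add up to pi / c times the kernel at exp (- 2 pi c). *)
Definition poisson_term c k y : R :=
  pi / c * (2 ^+ k.+1)^-1 *
  poisson_kernel (expR (- (2 * pi * c / 2 ^+ k.+1))) (y / 2 ^+ k.+1).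

(** With h = 1 / 2 ^ k.+1, the quotients (1 - q) / h and sin (pi y h) / h tend to the derivatives 2
    pi c and pi y; dividing the numerator by h and the denominator by h^2 uses up the factor h of
    the term. *)
Lemma cvg_poisson_term c y : 0 < c ->
  (fun k => poisson_term c k y) @ \oo --> 1 / (c ^+ 2 + y ^+ 2).
Proof.
move=> c0.
pose h k : R := (2 ^+ k.+1)^-1.
have hn0 k : h k != 0 by rewrite invr_eq0 expf_neq0// pnatr_eq0.
have h0 : h @ \oo --> 0 := cvg_half_pow.
pose q k := expR (- (2 * pi * c * h k)).
have dq : (fun k => (1 - q k) / h k) @ \oo --> 2 * pi * c.
  apply: (@cvg_derive0 (fun t => 1 - expR (- (2 * pi * c * t)))) => //; last first.
    by rewrite mulr0 oppr0 expR0 subrr.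
  have := is_deriveB (is_derive_cst (1 : R) (0 : R) (1 : R))
    (is_derive1_comp (is_derive_expR _) (is_derive_mull (- (2 * pi * c)) 0)).
  rewrite mulr0 expR0 mul1r sub0r opprK; apply: is_derive_eqfun.
  by move=> t; rewrite -[in RHS]mulNr.
have ds : (fun k => sin (pi * (y * h k)) / h k) @ \oo --> pi * y.
  apply: (@cvg_derive0 (fun t => sin (pi * (y * t)))) => //; last first.
    by rewrite !mulr0 sin0.
  have := is_derive1_comp (is_derive_sin _) (is_derive_mull (pi * y) 0).
  rewrite mulr0 cos0 mul1r; apply: is_derive_eqfun.
  by move=> t; rewrite [in RHS]mulrA.
have q1 : q @ \oo --> (1 : R).
  rewrite -[X in _ --> X]expR0; apply: (continuous_cvg _ (@continuous_expR R _)).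
  rewrite -[X in _ --> X]oppr0 -[X in - X](mulr0 (2 * pi * c)).
  by apply: cvgN; apply: cvgM => //; exact: cvg_cst.
have E k : poisson_term c k y = pi / c * ((1 - q k) / h k * (1 + q k)) /
    (((1 - q k) / h k) ^+ 2 + 4 * q k * (sin (pi * (y * h k)) / h k) ^+ 2).
  have := hn0 k; rewrite /poisson_term -/(h k) -/(q k) poisson_kernel_sin.
  move: (h k) (q k) => t r t0.
  rewrite !expr_div_n [4 * _ * (_ / _)]mulrA -mulrDl invfM invrK.
  move: ((1 - r) ^+ 2 + 4 * r * _)^-1 => D.
  by field; rewrite t0 gt_eqF.
rewrite (funext E).
have pc : pi != 0 :> R by rewrite gt_eqF// pi_gt0.
have c2y : 0 < c ^+ 2 + y ^+ 2 by rewrite ltr_wpDr ?sqr_ge0// exprn_gt0.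
rewrite (_ : 1 / _ = pi / c * (2 * pi * c * (1 + 1)) /
    ((2 * pi * c) ^+ 2 + 4 * 1 * (pi * y) ^+ 2)); last first.
  rewrite (_ : (2 * pi * c) ^+ 2 + _ = 4 * pi ^+ 2 * (c ^+ 2 + y ^+ 2)); last by ring.
  move: (pi : R) pc => p pc; field; rewrite pc (gt_eqF c0) (gt_eqF c2y)//.
have sq (v : nat -> R) (l : R) : v @ \oo --> l -> (fun k => v k ^+ 2) @ \oo --> l ^+ 2.
  exact: (continuous_cvg _ (@exprn_continuous R 2 _)).
have num : (fun k => pi / c * ((1 - q k) / h k * (1 + q k))) @ \oo -->
    pi / c * (2 * pi * c * (1 + 1)).
  apply: cvgM; first exact: cvg_cst.
  by apply: cvgM => //; apply: cvgD => //; exact: cvg_cst.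
have den : (fun k => ((1 - q k) / h k) ^+ 2 +
    4 * q k * (sin (pi * (y * h k)) / h k) ^+ 2) @ \oo -->
    (2 * pi * c) ^+ 2 + 4 * 1 * (pi * y) ^+ 2.
  apply: cvgD; first exact: sq.
  apply: cvgM; last exact: sq.
  by apply: cvgM => //; exact: cvg_cst.
apply: (cvgM num (cvgV _ den)).
rewrite (_ : (2 * pi * c) ^+ 2 + _ = 4 * pi ^+ 2 * (c ^+ 2 + y ^+ 2)); last by ring.
by rewrite gt_eqF// mulr_gt0// mulr_gt0// exprn_gt0// pi_gt0.
Qed.

End PartialFractionsLimit.

(** * A bound on the terms, uniform in the level of duplication *)

Section PartialFractionsSum.
Variable R : realType.
Implicit Types (q x y c h t : R).

(** With u = t / 2, the mean value theorem gives sin u >= u cos u, hence sin t >= 2 u cos^2 u = u (1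
    + cos t) >= u. *)
Lemma sin_ge_half t : 0 <= t <= pi / 2 -> t / 2 <= sin t.
Proof.
move=> /andP[t0 tp].
have [->|tn0] := eqVneq t 0; first by rewrite sin0 mul0r.
have {t0 tn0}t0 : 0 < t by rewrite lt_neqAle eq_sym tn0.
have pp := pi_gt0 R.
pose u := t / 2; have u0 : 0 < u by rewrite divr_gt0.
have up : u <= pi / 4 by rewrite /u; lra.
have [v] : exists2 v, v \in `]0, u[%R & sin u - sin 0 = cos v * (u - 0).
  apply: MVT => //; apply: continuous_subspaceT => z; exact: continuous_sin.
rewrite in_itv/= sin0 !subr0 => /andP[v0 vu] su.
have cuv : cos u <= cos v.
  rewrite ltW// ltr_cos// in_itv/=; apply/andP; split; lra.
have cu : 0 <= cos u by apply: cos_ge0_pihalf; apply/andP; split; lra.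
have ct : 0 <= cos t by apply: cos_ge0_pihalf; apply/andP; split; lra.
have tu : t = u *+ 2 by rewrite -mulr_natr divfK.
move: ct; rewrite {1 3}tu cos_mulr2n sin_mulr2n.
rewrite -[_ *+ 2]mulr_natl -(mulr_natl (cos u * _)) => ct.
have : u * cos u <= sin u by rewrite su mulrC ler_wpM2r// ltW.
have -> : t / 2 = u by [].
nra.
Qed.

Lemma sqr_sin_ge t : `|t| <= pi / 2 -> t ^+ 2 / 4 <= sin t ^+ 2.
Proof.
move=> tp.
have -> : sin t ^+ 2 = sin `|t| ^+ 2 by case: (ger0P t) => // _; rewrite sinN sqrrN.
have /sin_ge_half h : 0 <= `|t| <= pi / 2 by rewrite normr_ge0.
rewrite -real_normK ?num_real//; have := normr_ge0 t; nra.
Qed.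

Lemma poisson_term_bound c : 0 < c -> exists2 K : R, 0 <= K &
  forall x (k : nat) (j : int), 0 <= x < 1 -> - (2 ^ k)%:Z <= j < (2 ^ k)%:Z ->
  0 <= poisson_term c k (x + j%:~R) <= K * (1 / (1 + j%:~R ^+ 2)).
Proof.
move=> c0; have pp := pi_gt0 R.
(* A lower bound for q at every level [k], because 2 h <= 1. *)
pose q0 := expR (- (pi * c)); have q00 : 0 < q0 := expR_gt0 _.
(* With y = x + j and 0 <= x < 1 one has 1 + j^2 <= 3 + 2 y^2, which is at most (3 / (4 c^2) + 2) (4
   c^2 + y^2); the factor 4 / q0^2 comes from the bound on the kernel. *)
exists (4 * (3 / (4 * c ^+ 2) + 2) / q0 ^+ 2).
  by rewrite divr_ge0 ?sqr_ge0// mulr_ge0// addr_ge0// divr_ge0// mulr_ge0// sqr_ge0.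
move=> x k j /andP[x0 x1] /andP[j0 j1].
rewrite /poisson_term; set h : R := (2 ^+ k.+1)^-1; set y := x + _.
have h0 : 0 < h by rewrite invr_gt0 exprn_gt0.
have h1 : 2 * h <= 1.
  rewrite /h exprS invfM mulrA divff ?mul1r// invf_le1 ?exprn_gt0//.
  by rewrite exprn_ege1// ler1n.
have hk : 2 * h * 2 ^+ k = 1 by rewrite /h exprS; field; rewrite expf_neq0.
have j0' : - 2 ^+ k <= j%:~R :> R.
  by move: j0; rewrite -(ler_int R) intrN -pmulrn natrX.
have j1' : j%:~R + 1 <= 2 ^+ k :> R.
  by move: j1; rewrite -lezD1 -(ler_int R) intrD -pmulrn natrX.
set t := 2 * pi * c * h; set q := expR (- t).
have t0 : 0 < t by rewrite !mulr_gt0.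
have q_gt0 : 0 < q := expR_gt0 _.
have q01 : 0 <= q < 1 by rewrite ltW//= expR_lt1 oppr_lt0.
have q_ge : q0 <= q.
  have tE : t = pi * c * (2 * h) by rewrite /t; ring.
  by rewrite ler_expR lerN2 tE ger_pMr// mulr_gt0.
have qt : 1 - q <= t by have := expR_ge1Dx (- t); rewrite -/q; lra.
have tq : t * q <= 1 - q.
  have := expR_ge1Dx t; rewrite -[t in expR t]opprK expRN -/q => h2.
  have : (1 + t) * q <= q^-1 * q by rewrite ler_wpM2r// ltW.
  by rewrite mulVf ?gt_eqF//; lra.
have yh : `|y * h| <= 1 / 2.
  have y0 : 0 <= (y + 2 ^+ k) * h by apply: mulr_ge0; [rewrite /y; lra|exact: ltW].
  have y1 : 0 <= (2 ^+ k - y) * h by apply: mulr_ge0; [rewrite /y; lra|exact: ltW].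
  have hm : 2 ^+ k * h = 1 / 2.
    by move: hk; rewrite mulrAC -mulrA; move: (2 ^+ k * h) => z zE; lra.
  move: y0 y1; rewrite mulrDl mulrBl hm ler_norml; lra.
have sy : pi ^+ 2 * (y * h) ^+ 2 / 4 <= sin (pi * (y * h)) ^+ 2.
  rewrite -exprMn; apply: sqr_sin_ge.
  by rewrite [`|_|]normrM (gtr0_norm pp) ler_wpM2l ?(ltW pp)// -[2^-1]mul1r.
apply/andP; split.
  by rewrite mulr_ge0 ?poisson_kernel_ge0// mulr_ge0 ?ltW// divr_gt0.
rewrite poisson_kernel_sin; set S := sin _ ^+ 2; rewrite -/S in sy.
(* Both terms of the denominator are bounded below by multiples of h^2, which cancels against the
   factor h of the term and the factor h in 1 - q <= t. *)
have D1 : h ^+ 2 * q0 ^+ 2 * pi ^+ 2 * (4 * c ^+ 2 + y ^+ 2) <=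
    (1 - q) ^+ 2 + 4 * q * S.
  have a1 : t ^+ 2 * q0 ^+ 2 <= (1 - q) ^+ 2.
    rewrite -exprMn ler_pXn2r// ?nnegrE; [|by rewrite mulr_ge0// ltW|lra].
    by apply: le_trans tq; rewrite ler_wpM2l// ltW.
  have q0q : q0 ^+ 2 <= q by case/andP: q01 => _ ?; nra.
  have a2 : q0 ^+ 2 * (pi ^+ 2 * (y * h) ^+ 2) <= 4 * q * S.
    have p0 : 0 <= pi ^+ 2 * (y * h) ^+ 2 by rewrite mulr_ge0// sqr_ge0.
    apply: (@le_trans _ _ (q * (pi ^+ 2 * (y * h) ^+ 2))); first exact: ler_wpM2r.
    have -> : 4 * q * S = q * (4 * S) by ring.
    by apply: ler_wpM2l; [exact: ltW|lra].
  apply: le_trans (lerD a1 a2); rewrite le_eqVlt; apply/orP; left; apply/eqP.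
  by rewrite /t; ring.
have c2 : 0 < c ^+ 2 by rewrite exprn_gt0.
have y2 : 0 <= y ^+ 2 by rewrite sqr_ge0.
have Y0 : 0 < 4 * c ^+ 2 + y ^+ 2 by lra.
have C0 : 0 < h ^+ 2 * q0 ^+ 2 * pi ^+ 2 * (4 * c ^+ 2 + y ^+ 2).
  by rewrite !mulr_gt0// exprn_gt0.
have D0 := lt_le_trans C0 D1.
apply: (@le_trans _ _ (pi / c * h * (t * 2 /
    (h ^+ 2 * q0 ^+ 2 * pi ^+ 2 * (4 * c ^+ 2 + y ^+ 2))))).
  rewrite ler_wpM2l//; first by rewrite mulr_ge0 ?ltW// divr_gt0.
  apply: ler_pM.
  - by case/andP: q01 => _ ?; rewrite mulr_ge0//; lra.
  - by rewrite invr_ge0 ltW.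
  - by case/andP: q01 => _ ?; rewrite ler_pM//; lra.
  - by rewrite lef_pV2.
have -> : pi / c * h * (t * 2 /
    (h ^+ 2 * q0 ^+ 2 * pi ^+ 2 * (4 * c ^+ 2 + y ^+ 2))) =
    4 / q0 ^+ 2 * (4 * c ^+ 2 + y ^+ 2)^-1.
  rewrite /t; move: (pi : R) pp => p pp.
  by field; rewrite !gt_eqF.
have -> : 4 * (3 / (4 * c ^+ 2) + 2) / q0 ^+ 2 * (1 / (1 + j%:~R ^+ 2)) =
    4 / q0 ^+ 2 * ((3 / (4 * c ^+ 2) + 2) / (1 + j%:~R ^+ 2)).
  by rewrite mul1r -!mulrA; congr (_ * _); rewrite mulrCA.
rewrite ler_wpM2l//; first by rewrite divr_ge0// ltW// exprn_gt0.
have J0 : 0 <= (j%:~R : R) ^+ 2 by rewrite sqr_ge0.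
rewrite ler_pdivlMr; last lra.
rewrite mulrC ler_pdivrMr//.
have -> : (3 / (4 * c ^+ 2) + 2) * (4 * c ^+ 2 + y ^+ 2) =
    3 + 3 / (4 * c ^+ 2) * y ^+ 2 + 8 * c ^+ 2 + 2 * y ^+ 2.
  by field; rewrite gt_eqF.
have : 0 <= 3 / (4 * c ^+ 2) * y ^+ 2 by rewrite mulr_ge0// divr_ge0//; lra.
have -> : (j%:~R : R) = y - x by rewrite /y; ring.
have xy := sqr_ge0 (y + x); have x2 : x ^+ 2 <= 1 by rewrite expr_le1// ltW.
move: xy x2 c2; clear; move: y => y; rewrite sqrrD sqrrB.
move: (y ^+ 2) (x ^+ 2) (c ^+ 2) (y * x) (3 / _ * _) => *; lra.
Qed.

End PartialFractionsSum.

(** * The partial fraction expansion of the Poisson kernel *)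

Section PartialFractionsMain.
Variable R : realType.

(* The 2 ^ k.+1 translates are centred so that the arguments x + j, once divided
   by 2 ^ k.+1, stay in [-1/2, 1/2], where |sin (pi t)| >= pi |t| / 2. *)
Definition poisson_trunc (c x : R) k (j : int) : R :=
  if - (2 ^ k)%:Z <= j < (2 ^ k)%:Z then poisson_term c k (x + j%:~R) else 0.

Lemma poisson_trunc_ge0 (c x : R) k (j : int) : 0 < c -> 0 <= poisson_trunc c x k j.
Proof.
move=> c0; rewrite /poisson_trunc; case: ifP => // _.
rewrite mulr_ge0 ?poisson_kernel_ge0//.
  by rewrite mulr_ge0// divr_ge0 ?pi_ge0// ltW.
by rewrite expR_ge0/= expR_lt1 oppr_lt0 !mulr_gt0 ?pi_gt0.
Qed.

(** An exact identity at every level: this is [poisson_kernel_replicate] started at x - 2 ^ k, a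
    shift that periodicity removes. *)
Lemma esum_poisson_trunc (c x : R) k : 0 < c ->
  (\esum_(j in [set: int]) (poisson_trunc c x k j)%:E)%E =
  (pi / c * poisson_kernel (expR (- (2 * pi * c))) x)%:E.
Proof.
move=> c0.
pose s := [seq i%:Z - (2 ^ k)%:Z | i : 'I_(2 ^ k.+1)].
have us : uniq s.
  by rewrite map_inj_uniq ?enum_uniq// => i j /addIr[] /ord_inj.
rewrite (esum_finite_support us) => [|j|j js]; last 2 first.
- exact: poisson_trunc_ge0.
- rewrite /poisson_trunc; case: ifPn => // jk; case/negP: js.
  have h : (absz (j + (2 ^ k)%:Z)%R < 2 ^ k.+1)%N by rewrite expnS; lia.
  by apply/mapP; exists (Ordinal h); rewrite ?mem_enum//=; lia.
congr (_%:E); rewrite big_map big_enum/=.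
set q := expR (- (2 * pi * c / 2 ^+ k.+1)).
have h0 : 2 ^+ k.+1 != 0 :> R by rewrite expf_neq0.
have E (i : 'I_(2 ^ k.+1)) : poisson_trunc c x k (i%:Z - (2 ^ k)%:Z) =
   pi / c * (2 ^+ k.+1)^-1 *
   poisson_kernel q ((x + (- (2 ^ k)%:Z)%:~R + i%:R) / 2 ^+ k.+1).
  have ik : - (2 ^ k)%:Z <= i%:Z - (2 ^ k)%:Z < (2 ^ k)%:Z.
    by have := ltn_ord i; have := expnS 2 k; lia.
  rewrite /poisson_trunc ik /poisson_term -/q.
  by rewrite intrD -(pmulrn _ i) [i%:R + _]addrC addrA.
rewrite (eq_bigr _ (fun i _ => E i)) -mulr_sumr poisson_kernel_replicate.
  rewrite poisson_kernelDz mulrA divfK// -expRM_natl.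
  congr (_ * poisson_kernel (expR _) _).
  by rewrite natrX mulrN mulrC divfK.
by rewrite expR_ge0/= expR_lt1 oppr_lt0 divr_gt0 ?exprn_gt0// !mulr_gt0 ?pi_gt0.
Qed.

Lemma cvg_poisson_trunc (c x : R) (j : int) : 0 < c ->
  (fun k => poisson_trunc c x k j) @ \oo --> 1 / (c ^+ 2 + (x + j%:~R) ^+ 2).
Proof.
move=> c0; move: (@cvg_poisson_term R c (x + j%:~R) c0); apply: cvg_trans.
apply: near_eq_cvg; near=> k; rewrite /poisson_trunc ifT//.
have : (`|j| < 2 ^ k)%N.
  apply: (@leq_ltn_trans k); last exact: ltn_expl.
  by near: k; exact: nbhs_infty_ge.
lia.
Unshelve. all: by end_near.
Qed.

(** The case c = 1, x = 0 of the upper bound in the expansion, which needs only termwise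
    convergence; the result then serves as majorant in the tightness proofs. *)
Lemma esum_inv_sqr_lty :
  (\esum_(j in [set: int]) (1 / (1 + j%:~R ^+ 2) : R)%:E < +oo)%E.
Proof.
apply: (@le_lt_trans _ _ (pi / 1 * poisson_kernel (expR (- (2 * pi * 1))) 0 : R)%:E);
  last exact: ltry.
apply: (@esum_cvg_bounded _ _ (poisson_trunc 1 0)).
  move=> j; have := @cvg_poisson_trunc 1 0 j ltr01.
  by rewrite expr1n add0r.
by apply: nearW => k; rewrite esum_poisson_trunc.
Qed.

Lemma tight_poisson_trunc (c x : R) : 0 < c -> 0 <= x < 1 ->
  tight (poisson_trunc c x).
Proof.
move=> c0 x01.
have [K K0 Kb] := poisson_term_bound c0.
apply: (tight_dominated (h := fun j : int => 1 / (1 + j%:~R ^+ 2)) (i := fun=> id)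
  _ esum_inv_sqr_lty K0).
- by move=> j; rewrite divr_ge0// addr_ge0// sqr_ge0.
- by apply: nearW => k i j.
- apply: nearW => k j; rewrite poisson_trunc_ge0//= /poisson_trunc.
  case: ifPn => jk; first by have /andP[] := Kb x k j x01 jk.
  by rewrite mulr_ge0// divr_ge0// addr_ge0// sqr_ge0.
- by move=> s; exists s; apply: nearW.
Qed.

Lemma esum_partial_fractions01 (c x : R) : 0 < c -> 0 <= x < 1 ->
  (\esum_(j in [set: int]) (1 / (c ^+ 2 + (x + j%:~R) ^+ 2))%:E)%E =
  (pi / c * poisson_kernel (expR (- (2 * pi * c))) x)%:E.
Proof.
move=> c0 x01; apply/le_anti/andP; split.
  apply: (@esum_cvg_bounded _ _ (poisson_trunc c x)).
    by move=> j; exact: cvg_poisson_trunc.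
  by apply: nearW => k; rewrite esum_poisson_trunc.
apply: (@esum_cvg_ge _ _ (poisson_trunc c x)).
- by move=> j; exact: cvg_poisson_trunc.
- exact: tight_poisson_trunc.
- by apply: nearW => k; rewrite esum_poisson_trunc.
Qed.

Lemma esum_partial_fractions (c x : R) : 0 < c ->
  (\esum_(j in [set: int]) (1 / (c ^+ 2 + (x + j%:~R) ^+ 2))%:E)%E =
  (pi / c * poisson_kernel (expR (- (2 * pi * c))) x)%:E.
Proof.
move=> c0.
pose m := Num.floor x; pose y := x - m%:~R.
have xE : x = y + m%:~R by rewrite subrK.
have y01 : 0 <= y < 1.
  have /andP[] := floor_itv x; rewrite -/m intrD => h1 h2.
  by rewrite subr_ge0 h1/= ltrBlDl.
rewrite xE poisson_kernelDz -esum_partial_fractions01//.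
rewrite (reindex_esum [set: int] [set: int] (fun j => j - m)).
  by apply: eq_esum => j _; rewrite intrB addrACA subrr addr0.
split=> // [i j _ _ /addIr//|j _].
by exists (j + m) => //; rewrite addrK.
Qed.

End PartialFractionsMain.

(** * Integer lattices *)

Section Characters.
Variable R : realType.
Implicit Types (x y r : R).

Lemma big_int_boxS (V : zmodType) (K : nat) (f : int -> V) :
  \sum_(i < K.+1.*2.+1) f (int_box i) =
  f (- K.+1%:Z) + \sum_(i < K.*2.+1) f (int_box i) + f K.+1%:Z.
Proof.
rewrite /int_box -(big_mkord xpredT (fun i : nat => f (i%:Z - K.+1%:Z))).
rewrite -(big_mkord xpredT (fun i : nat => f (i%:Z - K%:Z))).
rewrite doubleS big_nat_recl// big_nat_recr//= addrA; congr (_ + _ + _).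
- by rewrite sub0r.
- by apply: eq_bigr => i _; congr f; lia.
- by congr f; lia.
Qed.

(** Multiplying by the denominator telescopes the partial sum, through the recurrence cos ((K + 2)
    u) = 2 cos u cos ((K + 1) u) - cos (K u); only boundary terms remain, of size r ^ K. *)
Lemma poisson_kernel_partial r x K :
  (1 - 2 * r * cos (2 * pi * x) + r ^+ 2) *
    (\sum_(i < K.*2.+1) r ^+ `|int_box i| * cos (2 * pi * ((int_box i)%:~R * x))) =
  1 - r ^+ 2 - 2 * r ^+ K.+1 * cos (2 * pi * (K.+1%:R * x))
    + 2 * r ^+ K.+2 * cos (2 * pi * (K%:R * x)).
Proof.
elim: K => [|K IH].
  rewrite big_ord1 /int_box/= subrr mul0r !mulr0 cos0 expr0 !mul1r expr1.
  by rewrite !mulr1; ring.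
rewrite (big_int_boxS K (fun j => r ^+ `|j| * cos (2 * pi * (j%:~R * x)))).
rewrite abszN absz_nat intrN !mulNr !mulrN cosN -!pmulrn.
move: IH; set S := \sum_(i < _) _; set C := cos (2 * pi * (K.+1%:R * x)).
set D := 1 - _ + _ => IH.
rewrite (_ : D * _ = D * S + 2 * r ^+ K.+1 * C * D); last by ring.
rewrite {}IH {}/S {}/D.
have : cos (2 * pi * (K.+2%:R * x)) =
    2 * cos (2 * pi * x) * C - cos (2 * pi * (K%:R * x)).
  have -> : 2 * pi * (K.+2%:R * x) = 2 * pi * (K.+1%:R * x) + 2 * pi * x.
    by rewrite -[in LHS](natr1 K.+1); ring.
  have -> : 2 * pi * (K%:R * x) = 2 * pi * (K.+1%:R * x) - 2 * pi * x.
    by rewrite -(natr1 K); ring.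
  by rewrite /C cosD cosB; ring.
by move=> ->; rewrite !exprS; ring.
Qed.

Lemma cvg_poisson_kernel r x : 0 <= r < 1 ->
  (fun K => \sum_(i < K.*2.+1)
     r ^+ `|int_box i| * cos (2 * pi * ((int_box i)%:~R * x))) @ \oo -->
  poisson_kernel r x.
Proof.
move=> r01; have d0 := poisson_denom_gt0 x r01.
set D := 1 - _ + _ in d0.
have /andP[r0 r1] := r01.
have cb (t : nat -> R) (m : nat) : (fun K => r ^+ (K + m) * cos (t K)) @ \oo --> 0.
  have c0 : (fun K => r ^+ K) @ \oo --> 0 by apply: cvg_expr; rewrite ger0_norm.
  apply/norm_cvg0P; apply: (@squeeze_cvgr _ _ _ _ (fun=> 0) (fun K => r ^+ K)) => //.
    apply: nearW => K; rewrite normr_ge0/= normrM ger0_norm ?exprn_ge0//.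
    rewrite -[leRHS]mulr1 exprD -mulrA ler_wpM2l ?exprn_ge0//.
    by rewrite mulr_ile1// ?cos_max// ?exprn_ge0// exprn_ile1// ltW.
  exact: cvg_cst.
have E K : \sum_(i < K.*2.+1)
     r ^+ `|int_box i| * cos (2 * pi * ((int_box i)%:~R * x)) =
     (1 - r ^+ 2 - 2 * (r ^+ (K + 1) * cos (2 * pi * (K.+1%:R * x))) +
        2 * (r ^+ (K + 2) * cos (2 * pi * (K%:R * x)))) * D^-1.
  have := poisson_kernel_partial r x K; rewrite -/D addn1 addn2 !mulrA => <-.
  by rewrite [D * _]mulrC mulfK// gt_eqF.
rewrite (funext E) /poisson_kernel -/D.
have n1 : (fun K : nat =>
    1 - r ^+ 2 - 2 * (r ^+ (K + 1) * cos (2 * pi * (K.+1%:R * x))) +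
    2 * (r ^+ (K + 2) * cos (2 * pi * (K%:R * x)))) @ \oo -->
    1 - r ^+ 2 - 2 * 0 + 2 * 0.
  apply: cvgD; last by apply: cvgM; [exact: cvg_cst|exact: cb].
  apply: cvgD; first exact: cvg_cst.
  by apply: cvgN; apply: cvgM; [exact: cvg_cst|exact: cb].
rewrite !mulr0 subr0 addr0 in n1.
by apply: cvgM n1 _; exact: cvg_cst.
Qed.

End Characters.

(** * Orthogonality of the characters of a cyclic group *)

Section FiniteFourier.
Variable R : realType.
Implicit Types (x y r : R).

(** Complex values appear only in finite identities, for their multiplicativity; all limits are
    taken over the reals. *)
Definition unit_exp x : R[i] := (cos (2 * pi * x) +i* sin (2 * pi * x))%C.

Lemma unit_expD x y : unit_exp (x + y) = unit_exp x * unit_exp y.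
Proof.
rewrite /unit_exp mulrDr cosD sinD; apply/eqP; rewrite eq_complex /=.
by rewrite eqxx/= addrC.
Qed.

Lemma unit_exp_int (m : int) : unit_exp m%:~R = 1.
Proof.
have C : cos (2 * pi * m%:~R) = 1 :> R by rewrite -[2 * _ * _]add0r cosD2piMz cos0.
rewrite /unit_exp C; congr (_ +i* _)%C; apply/eqP.
by rewrite -norm_cos_eq1 C normr1.
Qed.

Lemma unit_exp0 : unit_exp 0 = 1.
Proof. exact: (unit_exp_int 0). Qed.

Lemma unit_exp_sum (I : Type) (s : seq I) (f : I -> R) :
  unit_exp (\sum_(i <- s) f i) = \prod_(i <- s) unit_exp (f i).
Proof. exact: (big_morph unit_exp unit_expD unit_exp0). Qed.

Lemma unit_expMn x m : unit_exp (m%:R * x) = unit_exp x ^+ m.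
Proof.
elim: m => [|m IH]; first by rewrite mul0r unit_exp0.
by rewrite -natr1 mulrDl mul1r unit_expD IH exprSr.
Qed.

Lemma unit_exp_neq1 x : 0 < x < 1 -> unit_exp x != 1.
Proof.
move=> /andP[x0 x1]; apply/negP => /eqP [+ _].
have : 0 < sin (pi * x).
  by rewrite sin_gt0_pi// mulr_gt0 ?pi_gt0//= gtr_pMr// pi_gt0.
rewrite (_ : 2 * pi * x = (pi * x) *+ 2); last by rewrite -mulrA mulr_natl.
by rewrite cos_mulr2n cos2sin2; nra.
Qed.

Lemma unit_exp_dvd (l d : int) : d != 0 ->
  (unit_exp (l%:~R / d%:~R) == 1) = (d %| l)%Z.
Proof.
move=> d0; have dR : d%:~R != 0 :> R by rewrite intr_eq0.
have E : l%:~R / d%:~R = (l %/ d)%Z%:~R + (l %% d)%Z%:~R / d%:~R :> R.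
  by rewrite [in LHS](divz_eq l d) intrD intrM mulrDl mulfK.
rewrite E unit_expD unit_exp_int mul1r.
have m0 := modz_ge0 l d0; have m1 := ltz_mod l d0.
apply/idP/idP => [|/dvdz_mod0P ->]; last by rewrite mul0r unit_exp0.
apply: contraLR => /dvdz_mod0P/eqP n0.
have {m0}m0 : 0 < (l %% d)%Z by rewrite lt_neqAle eq_sym n0.
have u01 : 0 < ((l %% d)%Z%:~R / `|d|%:~R : R) < 1.
  rewrite divr_gt0 ?ltr0z ?normr_gt0//= ltr_pdivrMr ?ltr0z ?normr_gt0//.
  by rewrite mul1r ltr_int.
(* For negative [d] the fraction is the opposite of a point of the open unit interval, and
   [unit_exp] is 1 at both or at neither. *)
have [dp|dn] := ger0P d; first by have := unit_exp_neq1 u01; rewrite ger0_norm.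
have := unit_exp_neq1 u01; rewrite ltr0_norm//; apply: contra => /eqP u1.
set m := (l %% d)%Z in u1 *.
have := unit_exp0; rewrite -(subrr (m%:~R / d%:~R)) unit_expD u1 mul1r => u2.
by rewrite intrN invrN mulrN; apply/eqP.
Qed.

(** A geometric sum: if its ratio z differs from 1, multiplying by z - 1 gives z ^ |d| - 1 = 0. *)
Lemma sum_unit_exp (l d : int) : d != 0 ->
  \sum_(a < `|d|) unit_exp (a%:R * (l%:~R / d%:~R)) =
  if (d %| l)%Z then (`|d|%N)%:R else 0.
Proof.
move=> d0; under eq_bigr do rewrite unit_expMn.
rewrite -unit_exp_dvd//; set z := unit_exp _.
case: eqVneq => [->|z1].
  by under eq_bigr do rewrite expr1n; rewrite sumr_const card_ord.
apply: (mulfI (x := z - 1)); first by rewrite subr_eq0.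
rewrite mulr0 -subrX1 -unit_expMn.
apply/eqP; rewrite subr_eq0; apply/eqP.
have dR : d%:~R != 0 :> R by rewrite intr_eq0.
have [dp|dn] := ger0P d.
  by rewrite pmulrn gez0_abs// mulrC divfK// unit_exp_int.
rewrite pmulrn ltz0_abs// intrN mulNr mulrC divfK//.
by rewrite -intrN unit_exp_int.
Qed.

(** The imaginary parts cancel between j and -j. *)
Lemma sum_int_box_unit_exp r x K :
  \sum_(i < K.*2.+1) (r ^+ `|int_box i|)%:C%C * unit_exp ((int_box i)%:~R * x) =
  (\sum_(i < K.*2.+1) r ^+ `|int_box i| * cos (2 * pi * ((int_box i)%:~R * x)))%:C%C.
Proof.
elim: K => [|K IH].
  rewrite !big_ord1 /int_box/= subrr mul0r unit_exp0 expr0 mulr0 cos0 !mulr1.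
  by [].
rewrite (big_int_boxS K (fun j => (r ^+ `|j|)%:C%C * unit_exp (j%:~R * x))).
rewrite (big_int_boxS K (fun j => r ^+ `|j| * cos (2 * pi * (j%:~R * x)))).
rewrite IH !abszN intrN !mulNr !rmorphD/= /unit_exp !mulrN cosN sinN.
apply/eqP; rewrite eq_complex/=.
by apply/andP; split; apply/eqP; ring.
Qed.

End FiniteFourier.

(** * Both sums over the residues modulo the elementary divisors *)

Section RationalLattice.
Variables (R : realType) (n : nat) (d : 'I_n -> int) (W : 'M[int]_n).
Hypothesis d_neq0 : forall j, d j != 0.

Let D := (\max_j `|d j|%N).+1.

(** Representatives of the product of the groups Z / d_j. The common bound [D] places coordinates of
    different ranges in a single finite type. *)
Definition residues : pred {ffun 'I_n -> 'I_D} :=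
  family (fun j => [pred a : 'I_D | (a < `|d j|)%N]).

(* The coordinates of a *m diag(d)^-1 *m W^T: these points form the dual of the
   lattice Z^n *m diag(d) *m W^-1 tested by [in_lattice]. *)
Definition dual_coord (a : 'I_n -> int) (i : 'I_n) : R :=
  \sum_j (a j)%:~R / (d j)%:~R * (W i j)%:~R.

Definition in_lattice (k : 'rV[int]_n) : bool :=
  [forall j, (d j %| (k *m W) 0%R j)%Z].

(** After exchanging the sums, each k carries the sum over a of a product of characters, which
    factors over j; by orthogonality it is the product of the |d_j| when all d_j divide (k W)_j, and
    0 otherwise. *)
Lemma sum_residues_box (r : R) K :
  \sum_(a in residues) \prod_i \sum_(k < K.*2.+1) r ^+ `|int_box k| *
    cos (2 * pi * ((int_box k)%:~R * dual_coord (fun j => (a j)%:Z) i)) =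
  (\prod_j `|d j|)%N%:R *
  \sum_(t : {ffun 'I_n -> 'I_K.*2.+1})
     if in_lattice (row_box t) then \prod_i r ^+ `|row_box t 0 i| else 0.
Proof.
apply: complexI; rewrite rmorph_sum/=.
under eq_bigr => a _.
  rewrite rmorph_prod/=.
  under eq_bigr do rewrite -sum_int_box_unit_exp.
  rewrite bigA_distr_bigA/=.
  under eq_bigr do rewrite big_split/= -unit_exp_sum.
  over.
rewrite exchange_big/= rmorphM/= rmorph_sum/= mulr_sumr.
apply: eq_bigr => t _; rewrite -mulr_sumr.
pose l := row_box t *m W.
(* The pairing of k with the dual point of a is the sum over j of a_j (k W)_j / d_j, so the
   character splits over j. *)
have E (a : {ffun 'I_n -> 'I_D}) : unit_exp
   (\sum_i (int_box (t i))%:~R * dual_coord (fun j => (a j)%:Z) i) =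
   \prod_j unit_exp ((a j)%:R * ((l 0 j)%:~R / (d j)%:~R) : R).
  rewrite -unit_exp_sum; congr unit_exp.
  under eq_bigr do rewrite mulr_sumr.
  rewrite exchange_big/=; apply: eq_bigr => j _.
  rewrite /l mxE rmorph_sum/= mulr_suml mulr_sumr; apply: eq_bigr => i _.
  by rewrite intrM !mxE -pmulrn; ring.
rewrite (eq_bigr _ (fun a _ => E a)).
rewrite -(bigA_distr_big_dep (fun j => [pred a : 'I_D | (a < `|d j|)%N])
  (fun j (a : 'I_D) => unit_exp (a%:R * ((l 0 j)%:~R / (d j)%:~R) : R))).
have F j : \sum_(a < D | (a < `|d j|)%N)
     unit_exp (a%:R * ((l 0 j)%:~R / (d j)%:~R) : R) =
   if (d j %| l 0%R j)%Z then (`|d j|%N)%:R else 0.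
  rewrite -sum_unit_exp//.
  have le : (`|d j| <= D)%N by rewrite leqW// leq_bigmax.
  by rewrite (big_ord_widen _ (fun a : nat => unit_exp (a%:R * _ : R)) le).
rewrite (eq_bigr _ (fun j _ => F j)) -rmorph_prod/=.
case: ifPn => [/forallP kl|].
  rewrite mulrC; congr (_ * _); last first.
    by congr (_%:C)%C; apply: eq_bigr => i _; rewrite mxE.
  rewrite rmorph_nat natr_prod.
  by apply: eq_bigr => j _; rewrite kl.
rewrite negb_forall => /existsP[j lj].
by rewrite [X in _ * X](bigD1 j)//= (negPf lj) mul0r !mulr0.
Qed.

Lemma esum_in_lattice (c : R) : 0 < c ->
  (\esum_(k in [set: 'rV[int]_n])
    (if in_lattice k then \prod_i expR (- (2 * pi * c)) ^+ `|k 0 i| else 0)%:E)%E =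
  ((\prod_j `|d j|)%N%:R^-1 * \sum_(a in residues)
    \prod_i poisson_kernel (expR (- (2 * pi * c)))
       (dual_coord (fun j => (a j)%:Z) i))%:E.
Proof.
move=> c0; set r := expR _.
have r01 : 0 <= r < 1.
  by rewrite expR_ge0/= expR_lt1 oppr_lt0 !mulr_gt0 ?pi_gt0.
have d0 : (\prod_j `|d j|)%N%:R != 0 :> R.
  rewrite pnatr_eq0 -lt0n prodn_cond_gt0// => j _; rewrite absz_gt0; exact: d_neq0.
apply/esum_row.
  move=> k; case: ifP => // _; rewrite prodr_ge0// => i _.
  by rewrite exprn_ge0// expR_ge0.
have E K : \sum_(t : {ffun 'I_n -> 'I_K.*2.+1})
    (if in_lattice (row_box t) then \prod_i r ^+ `|row_box t 0 i| else 0) =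
    (\prod_j `|d j|)%N%:R^-1 * \sum_(a in residues) \prod_i \sum_(k < K.*2.+1)
      r ^+ `|int_box k| *
      cos (2 * pi * ((int_box k)%:~R * dual_coord (fun j => (a j)%:Z) i)).
  by rewrite sum_residues_box mulKf.
rewrite (funext E); apply: cvgM; first exact: cvg_cst.
under eq_fun do rewrite -big_enum; rewrite -big_enum.
apply: cvg_sum_seq => a; apply: cvg_prod_seq => i.
exact: cvg_poisson_kernel.
Qed.

Hypothesis W_unit : W \in unitmx.

(** The points [dual_coord] form the disjoint union of the translates of Z^n by the residues; on
    each translate the sum is a product of one-dimensional partial fraction expansions. *)
Lemma esum_dual_coord (c : R) : 0 < c ->
  (\esum_(z in [set: 'rV[int]_n])
    (\prod_i (1 / (c ^+ 2 + dual_coord (fun j => z 0 j) i ^+ 2)))%:E)%E =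
  (\sum_(a in residues)
    \prod_i (pi / c * poisson_kernel (expR (- (2 * pi * c)))
       (dual_coord (fun j => (a j)%:Z) i)))%:E.
Proof.
move=> c0.
pose W' := (invmx W)^T.
have WW : W' *m W^T = 1%:M by rewrite -trmx_mul mulmxV// trmx1.
have WW' : W^T *m W' = 1%:M by rewrite -trmx_mul mulVmx// trmx1.
(* Chosen so that the dual point of index e (a, b) is the dual point of a translated by b; [W']
   undoes the factor [W^T] in the coordinates. *)
pose e (ab : {ffun 'I_n -> 'I_D} * 'rV[int]_n) : 'rV[int]_n :=
  \row_j ((ab.1 j)%:Z + d j * (ab.2 *m W') 0 j).
have eD ab i : dual_coord (fun j => e ab 0 j) i =
    dual_coord (fun j => (ab.1 j)%:Z) i + (ab.2 0 i)%:~R.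
  have -> : ab.2 0 i = \sum_j (ab.2 *m W') 0 j * W i j.
    rewrite -[in LHS](mulmx1 ab.2) -WW mulmxA.
    by rewrite mxE; apply: eq_bigr => j _; rewrite [W^T _ _]mxE.
  rewrite rmorph_sum/= -big_split/=; apply: eq_bigr => j _.
  rewrite mxE intrD !intrM; have : (d j)%:~R != 0 :> R by rewrite intr_eq0 d_neq0.
  by move=> dj; field.
pose A := [set a : {ffun 'I_n -> 'I_D} | a \in residues].
have e_bij : set_bij (A `*` [set: 'rV[int]_n]) [set: 'rV[int]_n] e.
  have A_lt a j : A a -> (a j)%:Z < `|d j|.
    by move=> /familyP/(_ j); rewrite inE -abszE ltz_nat.
  (* Euclidean division recovers a as remainder; [modz_abs] covers negative [d j]. *)
  have e_mod a b j : A a -> (e (a, b) 0%R j %% d j)%Z = a j.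
    move=> Aa; rewrite mxE/= mulrC addrC modzMDl -modz_abs.
    by rewrite modz_small ?le0z_nat//= abszE A_lt.
  split=> //.
    move=> [a b] [a' b'] /set_mem[/= Aa _] /set_mem[/= Aa' _] /rowP ee.
    have aa : a = a'.
      apply/ffunP => j; apply/val_inj/eqP; rewrite -eqz_nat; apply/eqP.
      by rewrite -(e_mod _ b)// ee e_mod.
    congr (_, _) => //; rewrite -[b]mulmx1 -[b']mulmx1 -WW !mulmxA; congr (_ *m _).
    apply/rowP => j; have := ee j; rewrite !mxE/= aa => /addrI/mulfI; apply.
    exact: d_neq0.
  move=> z _.
  have h j : (absz (z 0%R j %% d j)%Z < D)%N.
    have := ltz_mod (z 0 j) (d_neq0 j); have := modz_ge0 (z 0 j) (d_neq0 j).
    have : (`|d j| < D)%N by rewrite ltnS leq_bigmax.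
    lia.
  exists ([ffun j => Ordinal (h j)], (\row_j (z 0%R j %/ d j)%Z) *m W^T).
    split=> //=; apply/familyP => j; rewrite inE ffunE/=.
    have := ltz_mod (z 0 j) (d_neq0 j); have := modz_ge0 (z 0 j) (d_neq0 j); lia.
  apply/rowP => j; rewrite mxE/= -mulmxA WW' mulmx1 mxE ffunE/=.
  by rewrite gez0_abs ?modz_ge0// addrC mulrC -divz_eq.
rewrite (reindex_esum _ _ e _ e_bij).
under eq_esum => ab _ do under eq_bigr do rewrite eD.
rewrite -(@esum_esum _ _ _ A (fun=> [set: 'rV[int]_n]) (fun a b => (\prod_i
  (1 / (c ^+ 2 + (dual_coord (fun j => (a j)%:Z) i + (b 0 i)%:~R) ^+ 2)))%:E)); last first.
  move=> a b _ _; rewrite lee_fin prodr_ge0// => i _.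
  by rewrite divr_ge0// addr_ge0// sqr_ge0.
under eq_esum => a _.
  rewrite (@esum_row_prod _ _ (fun i j => 1 / (c ^+ 2 +
    (dual_coord (fun j => (a j)%:Z) i + j%:~R) ^+ 2))
   (fun i => pi / c * poisson_kernel (expR (- (2 * pi * c)))
       (dual_coord (fun j => (a j)%:Z) i))); last 2 first.
  - by move=> i j; rewrite divr_ge0// addr_ge0// sqr_ge0.
  - by move=> i; exact: esum_partial_fractions.
  over.
rewrite esum_mkcond.
pose F a : R := if a \in residues then \prod_i (pi / c *
  poisson_kernel (expR (- (2 * pi * c))) (dual_coord (fun j => (a j)%:Z) i)) else 0.
rewrite (eq_esum (b := fun a => (F a)%:E)); last first.
  by move=> a _; rewrite /F -[a \in A]/(a \in [set` residues]) mem_setE; case: ifP.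
rewrite (@esum_finite_support _ _ F (enum {ffun 'I_n -> 'I_D})) ?enum_uniq//.
- by rewrite big_enum/= /F -big_mkcond.
- move=> a; rewrite /F; case: ifP => // _; apply: prodr_ge0 => i _.
  apply: mulr_ge0; first by rewrite divr_ge0 ?pi_ge0// ltW.
  apply: poisson_kernel_ge0.
  by rewrite expR_ge0/= expR_lt1 oppr_lt0 !mulr_gt0 ?pi_gt0.
- by move=> a; rewrite mem_enum.
Qed.

End RationalLattice.

(** * The formula for integer lattices, by Smith normal form *)

Section IntegerLattice.
Variables (R : realType) (n : nat).

Lemma mulmx_unit_bij (S : comUnitRingType) (P : 'M[S]_n) : P \in unitmx ->
  set_bij [set: 'rV[S]_n] [set: 'rV[S]_n] (fun z => z *m P).
Proof.
move=> Pu; split=> // [z z' _ _ /(congr1 (mulmx^~ (invmx P)))|z _].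
  by rewrite -!mulmxA mulmxV// !mulmx1.
by exists (z *m invmx P) => //; rewrite -mulmxA mulVmx// mulmx1.
Qed.

Lemma norm_det_int_unit (P : 'M[int]_n) : P \in unitmx -> (`|\det P| = 1)%N.
Proof.
by rewrite unitmxE; case: (\det P) => [[|[]]|[]].
Qed.

(** The adjugate stands in for the inverse over the integers. *)
Lemma mulmx_int_inj (A : 'M[int]_n) : \det A != 0 ->
  injective (fun z : 'rV[int]_n => z *m A).
Proof.
move=> A0 z z' /(congr1 (mulmx^~ (\adj A))); rewrite -!mulmxA mul_mx_adj.
rewrite !mul_mx_scalar => /rowP zz; apply/rowP => i.
by have := zz i; rewrite !mxE => /mulfI; apply.
Qed.

(** In A = P diag(d) Q the factor P only changes the basis, so the row lattice of A is Z^n diag(d)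
    Q, tested by W = Q^-1. Both sides reduce to one sum over the residues, whose number is |det
    A|. *)
Lemma poisson_int_lattice (A : 'M[int]_n) (c : R) : \det A != 0 -> 0 < c ->
  let B := invmx (map_mx intr A : 'M[R]_n)^T in
  (\esum_(z in [set: 'rV[int]_n])
    (\prod_i (1 / (c ^+ 2 + (map_mx intr z *m B) 0 i ^+ 2)))%:E)%E =
  ((`|\det A|%N%:R * (pi / c) ^+ n)%:E *
   \esum_(z in [set: 'rV[int]_n])
    (\prod_i expR (- (2 * pi * c)) ^+ `|(z *m A) 0 i|)%:E)%E.
Proof.
move=> A0 c0 B.
have [P Pu [Q Qu [d _ AE]]] := int_Smith_normal_form A.
pose d' (j : 'I_n) := d`_j.
have DE : (\matrix_(i, j) (d`_i *+ (i == j :> nat))) = diag_mx (\row_j d' j).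
  by apply/matrixP => i j; rewrite !mxE.
have {DE}AE : A = P *m diag_mx (\row_j d' j) *m Q by rewrite AE DE.
have detA : \det A = \det P * \prod_j d' j * \det Q.
  rewrite AE !det_mulmx det_diag; congr (_ * _ * _).
  by apply: eq_bigr => j _; rewrite mxE.
have d0 j : d' j != 0.
  by apply: contraNneq A0 => dj; rewrite detA (bigD1 j)//= dj !mul0r mulr0 mul0r.
have ndetA : (`|\det A| = \prod_j `|d' j|)%N.
  rewrite detA !abszM !norm_det_int_unit// mul1n muln1.
  by rewrite (big_morph absz abszM (erefl _)).
pose W := invmx Q.
have Wu : W \in unitmx by rewrite unitmx_inv.
have latE (k : 'rV[int]_n) :
    (range (fun z : 'rV[int]_n => z *m A) k) <-> in_lattice d' W k.
  split.
    move=> [z _ <-]; apply/forallP => j.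
    rewrite AE -2!mulmxA mulmxV// mulmx1 mulmxA.
    by rewrite mul_mx_diag !mxE dvdz_mull.
  move=> /forallP kd; pose y := \row_j ((k *m W) 0%R j %/ d' j)%Z.
  exists (y *m invmx P) => //.
  rewrite AE !mulmxA -(mulmxA y) mulVmx// mulmx1.
  rewrite (_ : y *m _ = k *m W); first by rewrite -mulmxA mulVmx// mulmx1.
  have yE j : y 0 j = ((k *m W) 0%R j %/ d' j)%Z by rewrite mxE.
  apply/rowP => j; rewrite mul_mx_diag mxE yE [(\row_j _) _ _]mxE.
  by rewrite divzK.
have -> : (\esum_(z in [set: 'rV[int]_n])
    (\prod_i expR (- (2 * pi * c)) ^+ `|(z *m A) 0 i|)%:E)%E =
    (\esum_(k in [set: 'rV[int]_n]) (if in_lattice d' W k then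
      \prod_i expR (- (2 * pi * c)) ^+ `|k 0 i| else 0)%:E)%E.
  rewrite -(esum_image [set: 'rV[int]_n] (fun z => z *m A)
    (fun k => (\prod_i expR (- (2 * pi * c)) ^+ `|k 0 i|)%:E)); last first.
    by move=> z z' _ _; exact: mulmx_int_inj.
  rewrite esum_mkcond; apply: eq_esum => k _.
  case: ifPn; rewrite ?inE ?notin_setE.
    by move=> /latE ->.
  by move=> /latE/negP/negPf ->.
rewrite esum_in_lattice// -EFinM.
pose AR : 'M[R]_n := map_mx intr A.
have ARu : AR^T \in unitmx.
  by rewrite unitmx_tr unitmxE unitfE det_map_mx intr_eq0.
have PTu : P^T \in unitmx by rewrite unitmx_tr.
(* The dual generator is the product of the inverse of P^T, the inverse of diag(d), and W^T;
   replacing z by z P^T leaves exactly [dual_coord]. *)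
rewrite (reindex_esum _ _ _ _ (mulmx_unit_bij PTu)).
have coordE (z : 'rV[int]_n) i : (map_mx intr (z *m P^T) *m B) 0 i =
    dual_coord R d' W (fun j => z 0 j) i.
  pose x : 'rV[R]_n := \row_i dual_coord R d' W (fun j => z 0 j) i.
  suff -> : map_mx intr (z *m P^T) *m B = x by rewrite mxE.
  suff <- : x *m AR^T = map_mx intr (z *m P^T) by rewrite -mulmxA mulmxV// mulmx1.
  have -> : x = (\row_j ((z 0 j)%:~R / (d' j)%:~R)) *m (map_mx intr W)^T.
    by apply/rowP => k; rewrite !mxE; apply: eq_bigr => j _; rewrite !mxE.
  rewrite -mulmxA -trmx_mul -map_mxM AE -mulmxA mulmxV// mulmx1.
  rewrite !map_mxM trmx_mul map_diag_mx tr_diag_mx mulmxA map_trmx.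
  congr (_ *m _); apply/rowP => j.
  rewrite mul_mx_diag !mxE divfK// intr_eq0; exact: d0.
under eq_esum => z _ do under eq_bigr do rewrite coordE.
rewrite esum_dual_coord//; congr (_%:E).
have splitE (f : 'I_n -> R) : \prod_i (pi / c * f i) = (pi / c) ^+ n * \prod_i f i.
  by rewrite big_split/= prodr_const card_ord.
rewrite (eq_bigr _ (fun a _ => splitE _)).
rewrite -mulr_sumr ndetA [X in _ = X * _]mulrC -[RHS]mulrA mulVKf//.
by rewrite pnatr_eq0 -lt0n prodn_gt0// => j; rewrite absz_gt0.
Qed.

End IntegerLattice.

(** * Approximation by rational lattices *)

Section MatrixLimits.
Variable R : realType.

Definition mx_cvg m n (M : nat -> 'M[R]_(m, n)) (M0 : 'M[R]_(m, n)) :=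
  forall i j, (fun N => M N i j) @ \oo --> M0 i j.

Lemma mx_cvg_det n (M : nat -> 'M[R]_n) (M0 : 'M[R]_n) :
  mx_cvg M M0 -> (fun N => \det (M N)) @ \oo --> \det M0.
Proof.
move=> MM0; rewrite /determinant; apply: cvg_sum_seq => s.
by apply: cvgM; [exact: cvg_cst|apply: cvg_prod_seq => i; exact: MM0].
Qed.

Lemma mx_cvg_unit n (M : nat -> 'M[R]_n) (M0 : 'M[R]_n) :
  mx_cvg M M0 -> M0 \in unitmx -> \forall N \near \oo, M N \in unitmx.
Proof.
rewrite unitmxE unitfE => /mx_cvg_det MM0 M00.
have : \forall N \near \oo, \det (M N) != 0 by exact: cvgr_neq0 MM0 M00.
by apply: filterS => N; rewrite unitmxE unitfE.
Qed.

(** Cramer's formula. It describes [invmx] only on invertible matrices, so the sequences agree only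
    for large [N]. *)
Lemma mx_cvg_inv n (M : nat -> 'M[R]_n) (M0 : 'M[R]_n) :
  mx_cvg M M0 -> M0 \in unitmx -> mx_cvg (fun N => invmx (M N)) (invmx M0).
Proof.
move=> MM0 M0u i j; have Mu := mx_cvg_unit MM0 M0u.
have : (fun N => (\det (M N))^-1 * cofactor (M N) j i) @ \oo --> invmx M0 i j.
  rewrite /invmx M0u !mxE; apply: cvgM.
    by apply: cvgV (mx_cvg_det MM0); rewrite -unitfE -unitmxE.
  apply: cvgM; first exact: cvg_cst.
  apply: mx_cvg_det => k l; rewrite !mxE.
  by under eq_fun do rewrite !mxE; exact: MM0.
apply: cvg_trans; apply: near_eq_cvg; apply: filterS Mu => N MNu.
by rewrite /invmx MNu !mxE.
Qed.

Lemma mx_cvg_bounded m n (M : nat -> 'M[R]_(m, n)) (M0 : 'M[R]_(m, n)) :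
  mx_cvg M M0 -> exists2 b : R, 0 <= b &
    \forall N \near \oo, forall i j, `|M N i j| <= b.
Proof.
move=> MM0; pose b := \sum_i \sum_j (`|M0 i j| + 1).
have b0 i j : `|M0 i j| < b.
  rewrite /b (bigD1 i)//= (bigD1 j)//= -!addrA ltr_pwDr// ltr_pwDl//.
  by rewrite addr_ge0// sumr_ge0// => k _; rewrite ?sumr_ge0// => *; rewrite addr_ge0.
exists b.
  by rewrite /b sumr_ge0// => k _; rewrite sumr_ge0// => *; rewrite addr_ge0.
near=> N => i j; move: i j; near: N.
suff : \forall N \near \oo, forall ij : 'I_m * 'I_n, `|M N ij.1 ij.2| <= b.
  by apply: filterS => N H i j; exact: (H (i, j)).
apply: filter_forall => -[i j] /=.
by apply: cvgr_norm_le; [exact: MM0|exact: b0].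
Unshelve. all: by end_near.
Qed.

Lemma mx_cvg_mull m n (z : 'rV[R]_m) (M : nat -> 'M[R]_(m, n)) (M0 : 'M[R]_(m, n)) :
  mx_cvg M M0 -> mx_cvg (fun N => z *m M N) (z *m M0).
Proof.
move=> MM0 i j; rewrite mxE; under eq_fun do rewrite mxE.
by apply: cvg_sum_seq => k; apply: cvgM; [exact: cvg_cst|exact: MM0].
Qed.

Lemma mx_cvg_tr m n (M : nat -> 'M[R]_(m, n)) (M0 : 'M[R]_(m, n)) :
  mx_cvg M M0 -> mx_cvg (fun N => (M N)^T) M0^T.
Proof. by move=> MM0 i j; rewrite mxE; under eq_fun do rewrite mxE; exact: MM0. Qed.

Lemma mx_cvg_floor m n (M : 'M[R]_(m, n)) :
  mx_cvg (fun N => \matrix_(i, j)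
    ((Num.floor (N.+1%:R * M i j))%:~R / N.+1%:R)) M.
Proof.
move=> i j; under eq_fun do rewrite mxE.
apply: (@squeeze_cvgr _ _ _ _ (fun N => M i j - N.+1%:R^-1) (fun=> M i j)).
- apply: nearW => N; have N0 : 0 < N.+1%:R :> R by [].
  have /andP[h1 h2] := floor_itv (N.+1%:R * M i j).
  rewrite ler_pdivrMr// [M i j * _]mulrC h1 andbT ler_pdivlMr// mulrBl mulVf ?gt_eqF//.
  by rewrite lerBlDr mulrC ltW// -[1]/(1%:~R) -intrD.
- rewrite -[X in _ --> X]subr0; apply: cvgB; first exact: cvg_cst.
  exact: cvg_harmonic.
- exact: cvg_cst.
Qed.

End MatrixLimits.

(** * Tightness along a convergent sequence of lattices *)

Section LatticeTightness.
Variable R : realType.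

Definition inv_sqr_row n (k : 'rV[int]_n) : R := \prod_i (1 / (1 + (k 0 i)%:~R ^+ 2)).

Lemma inv_sqr_row_ge0 n (k : 'rV[int]_n) : 0 <= inv_sqr_row k.
Proof. by apply: prodr_ge0 => i _; rewrite divr_ge0// addr_ge0// sqr_ge0. Qed.

Lemma esum_inv_sqr_row_lty n :
  (\esum_(k in [set: 'rV[int]_n]) (inv_sqr_row k)%:E < +oo)%E.
Proof.
rewrite (@esum_row_prod _ _ (fun i j => 1 / (1 + j%:~R ^+ 2))
  (fun=> fine (\esum_(j in [set: int]) (1 / (1 + j%:~R ^+ 2) : R)%:E)%E)) ?ltry//.
  by move=> i j; rewrite divr_ge0// addr_ge0// sqr_ge0.
move=> _; rewrite fineK// ge0_fin_numE ?esum_inv_sqr_lty//.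
by apply: esum_ge0 => j _; rewrite lee_fin divr_ge0// addr_ge0// sqr_ge0.
Qed.

(** For u = t / e and k its floor, |u - k| <= 1 gives k^2 <= 2 u^2 + 2, hence 1 + k^2 <= 3 + 2 t^2 /
    e^2. *)
Lemma inv_sqr_floor (t e : R) : 0 < e ->
  1 / (1 + t ^+ 2) <=
  (3 + 2 / e ^+ 2) * (1 / (1 + (Num.floor (t / e))%:~R ^+ 2)).
Proof.
move=> e0; set k : R := _%:~R; have /andP[k1 k2] := floor_itv (t / e).
rewrite -/k in k1; rewrite intrD -/k in k2.
have t2 := sqr_ge0 t; have kk := sqr_ge0 k.
rewrite mulrA mulr1 ler_pdivrMr; last lra.
rewrite mulrAC ler_pdivlMr ?mul1r; last lra.
have u2 : (t / e) ^+ 2 = t ^+ 2 / e ^+ 2 by rewrite expr_div_n.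
have ei : 0 <= 2 / e ^+ 2 by rewrite divr_ge0// sqr_ge0.
rewrite (_ : (3 + _) * _ = 3 + 3 * t ^+ 2 + 2 / e ^+ 2 + 2 * (t / e) ^+ 2); last first.
  by rewrite u2; ring.
move: (t / e) k1 k2 => u k1 k2.
have : k ^+ 2 <= 2 * u ^+ 2 + 2.
  by have := sqr_ge0 (u + (u - k)); have : (u - k) ^+ 2 <= 1; nra.
lra.
Qed.

(** General [g] and [w] let the lemma serve both sides of the formula; the weight carries the
    determinant, which varies with [N]. *)
Lemma tight_lattice n (M : nat -> 'M[R]_n) (M0 : 'M[R]_n) (g : R -> R) (K : R)
    (w : nat -> R) (w0 : R) :
  mx_cvg M M0 -> M0 \in unitmx ->
  (forall t, 0 <= g t <= K * (1 / (1 + t ^+ 2))) ->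
  w @ \oo --> w0 -> (forall N, 0 <= w N) ->
  tight (fun N (z : 'rV[int]_n) => w N * \prod_i g ((map_mx intr z *m M N) 0 i)).
Proof.
move=> MM0 M0u gK ww w_ge0.
have K0 : 0 <= K.
  by have /andP[g0 /(le_trans g0)] := gK 0; rewrite expr0n addr0 divr1 mulr1.
have [b b0 Mb] := mx_cvg_bounded (mx_cvg_inv MM0 M0u).
have Mu := mx_cvg_unit MM0 M0u.
have w00 : 0 <= w0 by apply: (cvgr_to_ge ww); apply: nearW.
have wb : \forall N \near \oo, w N <= w0 + 1.
  by apply: (cvgr_le w0) => //; rewrite ltrDl.
(* z = (z M) M^-1, so a bound on the coordinates of z M bounds z *)
have zb N (x : 'rV[R]_n) T : M N \in unitmx ->
    (forall i j, `|invmx (M N) i j| <= b) ->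
    (forall i, `|(x *m M N) 0 i| <= T) -> forall j, `|x 0 j| <= n%:R * b * T.
  move=> MNu MNb xT j.
  have -> : x = x *m M N *m invmx (M N) by rewrite -mulmxA mulmxV// mulmx1.
  rewrite mxE (le_trans (ler_norm_sum _ _ _))//.
  rewrite (le_trans (ler_sum _ (G := fun=> T * b) _))//.
    by move=> i _; rewrite normrM ler_pM.
  by rewrite sumr_const card_ord -[_ *+ n]mulr_natl [T * b]mulrC mulrA.
(* If z and z' round to the same point, the coordinates of (z - z') M are at most e, so those of z -
   z' are at most n b e < 1 and vanish. *)
pose e := (n%:R * b + 1)^-1.
have nb0 : 0 <= n%:R * b by rewrite mulr_ge0.
have e0 : 0 < e by rewrite invr_gt0 ltr_wpDl.
have nbe : n%:R * b * e < 1.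
  by rewrite ltr_pdivrMr ?ltr_wpDl// mul1r ltrDl.
(* rounding to a grid of mesh e so fine that distinct lattice points are separated *)
pose io N (z : 'rV[int]_n) : 'rV[int]_n :=
  \row_i Num.floor ((map_mx intr z *m M N) 0 i / e).
have fl (t : R) : `|t / e - (Num.floor (t / e))%:~R| < 1.
  have /andP[k1 k2] := floor_itv (t / e); rewrite intrD in k2.
  by rewrite ger0_norm ?subr_ge0// ltrBlDl.
apply: (@tight_dominated _ _ _ _ (@inv_sqr_row n) io
    ((w0 + 1) * (K * (3 + 2 / e ^+ 2)) ^+ n)).
- exact: inv_sqr_row_ge0.
- exact: esum_inv_sqr_row_lty.
- rewrite mulr_ge0 ?exprn_ge0 ?mulr_ge0 ?addr_ge0//.
  by rewrite divr_ge0// sqr_ge0.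
- near=> N => z z' /rowP zz.
  have MNu : M N \in unitmx by near: N.
  have MNb : forall i j, `|invmx (M N) i j| <= b by near: N.
  have h i : `|(map_mx intr (z - z') *m M N) 0 i| <= e.
    rewrite map_mxB mulmxBl mxE [X in _ + X]mxE; move: (zz i).
    rewrite [io N z 0 i]mxE [io N z' 0 i]mxE.
    move: ((map_mx intr z *m M N) 0 i) ((map_mx intr z' *m M N) 0 i) => u u' E.
    have -> : u - u' = (u / e - u' / e) * e by rewrite mulrBl !divfK ?gt_eqF.
    rewrite normrM (gtr0_norm e0) -[leRHS]mul1r ler_pM2r//.
    have /andP[p1 p2] := floor_itv (u / e); have /andP[p3 p4] := floor_itv (u' / e).
    rewrite -{}E !intrD in p1 p2 p3 p4 *.
    by rewrite ler_norml; apply/andP; split; lra.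
  apply/rowP => j; apply/eqP; rewrite -subr_eq0; apply/eqP.
  have := le_lt_trans (zb N _ e MNu MNb h j) nbe.
  rewrite !mxE -intr_norm ltrz1; move: (z 0 j) (z' 0 j) => x y; clear; lia.
- near=> N => z.
  have wN : w N <= w0 + 1 by near: N.
  rewrite mulr_ge0//=; last first.
    by apply: prodr_ge0 => i _; have /andP[] := gK ((map_mx intr z *m M N) 0 i).
  rewrite -mulrA ler_pM//.
    by apply: prodr_ge0 => i _; have /andP[] := gK ((map_mx intr z *m M N) 0 i).
  rewrite -[n in X in _ <= X * _]card_ord -prodr_const -big_split/=.
  apply: ler_prod => i _; have /andP[-> /=] := gK ((map_mx intr z *m M N) 0 i).
  move=> /le_trans; apply; rewrite -mulrA ler_wpM2l// [io _ _ _ _]mxE.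
  exact: inv_sqr_floor.
(* If z rounds into [t], the coordinates of z M are at most (T + 1) e, so z lies in a box that does
   not depend on [N]. *)
- move=> t; pose T := (\max_(k <- t) \max_i `|k 0%R i|)%N.
  pose Z := Num.bound (n%:R * b * (T.+1%:R * e)).
  exists [seq row_box u | u <- enum {ffun 'I_n -> 'I_Z.*2.+1}].
  near=> N => z zt; apply: mem_row_box => j.
  have MNu : M N \in unitmx by near: N.
  have MNb : forall i j, `|invmx (M N) i j| <= b by near: N.
  have h i : `|(map_mx intr z *m M N) 0 i| <= T.+1%:R * e.
    have : (`|io N z 0%R i| <= T)%N.
      apply: (@leq_trans (\max_i `|io N z 0%R i|)%N); first exact: leq_bigmax.
      exact: (leq_bigmax_seq (F := fun k : 'rV[int]_n => (\max_i `|k 0%R i|)%N)).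
    rewrite [io _ _ _ _]mxE; move: ((map_mx intr z *m M N) 0 i) => u.
    rewrite -(ler_nat R) natr_absz intr_norm => kT.
    rewrite -ler_pdivrMr// -[e in _ / e](gtr0_norm e0) -normf_div.
    rewrite -(subrK (Num.floor (u / e))%:~R (u / e)) -natr1 addrC.
    by rewrite (le_trans (ler_normD _ _))// lerD// ltW.
  have := zb N _ _ MNu MNb h j; rewrite mxE.
  have : n%:R * b * (T.+1%:R * e) < Z%:R.
    by apply: archi_boundP; rewrite mulr_ge0// mulr_ge0// ltW.
  move=> /[swap] /le_lt_trans /[apply] /ltW.
  by rewrite -intr_norm -abszE -pmulrn ler_nat.
Unshelve. all: by end_near.
Qed.

End LatticeTightness.

(** * From integer to rational to arbitrary lattices *)

Section PoissonLattice.
Variables (R : realType) (n : nat).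

(** The integer case at c = k / m. Rescaling gives m^(2 n) on the left; on the right |det A| and (pi
    / c)^n contribute m^n each. *)
Lemma poisson_rational_lattice (A : 'M[int]_n) (m : nat) (k : R) :
  \det A != 0 -> (0 < m)%N -> 0 < k ->
  let C := m%:R^-1 *: map_mx intr A : 'M[R]_n in
  (\esum_(z in [set: 'rV[int]_n])
     (\prod_i (1 / (k ^+ 2 + (map_mx intr z *m invmx C^T) 0 i ^+ 2)))%:E)%E =
  (\esum_(z in [set: 'rV[int]_n]) (`|\det C| * (pi / k) ^+ n *
     \prod_i expR (- (2 * pi * k * `|(map_mx intr z *m C) 0 i|)))%:E)%E.
Proof.
move=> A0 m0 k0 C.
have mR0 : 0 < m%:R :> R by rewrite ltr0n.
have km0 : 0 < k / m%:R by rewrite divr_gt0.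
have detA0 : \det (map_mx intr A : 'M[R]_n) != 0 by rewrite det_map_mx intr_eq0.
pose AR : 'M[R]_n := map_mx intr A.
have ARu : AR^T \in unitmx by rewrite unitmx_tr unitmxE unitfE.
have CE : invmx C^T = m%:R *: invmx AR^T.
  have CTu : C^T \in unitmx.
    by rewrite unitmx_tr unitmxE unitfE detZ mulf_neq0// expf_neq0// invr_neq0 ?gt_eqF.
  apply: (can_inj (mulKmx CTu)); rewrite mulmxV//.
  have -> : C^T = m%:R^-1 *: AR^T by apply/matrixP => i j; rewrite !mxE.
  rewrite -scalemxAl -scalemxAr scalerA mulVf ?gt_eqF// scale1r.
  by rewrite mulmxV.
have detC : `|\det C| = `|\det A|%N%:R / m%:R ^+ n.
  rewrite detZ normrM (ger0_norm (exprn_ge0 _ _)) ?invr_ge0 ?ltW// exprVn mulrC.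
  by rewrite det_map_mx -intr_norm natr_absz.
have := poisson_int_lattice A0 km0; rewrite /= -/AR => H.
have mn0 : 0 < (m%:R ^+ 2) ^+ n :> R by rewrite exprn_gt0// exprn_gt0.
have scaleE (z : 'rV[int]_n) : \prod_i (1 / ((k / m%:R) ^+ 2 +
      (map_mx intr z *m invmx AR^T) 0 i ^+ 2)) =
    (m%:R ^+ 2) ^+ n *
    \prod_i (1 / (k ^+ 2 + (map_mx intr z *m invmx C^T) 0 i ^+ 2)).
  transitivity (\prod_(i < n) (m%:R ^+ 2 *
      (1 / (k ^+ 2 + (map_mx intr z *m invmx C^T) 0 i ^+ 2))));
    last by rewrite big_split/= prodr_const card_ord.
  apply: eq_bigr => i _; rewrite CE -scalemxAr.
  have -> : (m%:R *: (map_mx intr z *m invmx AR^T)) 0 i =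
    m%:R * (map_mx intr z *m invmx AR^T) 0 i by rewrite mxE.
  move: ((map_mx intr z *m invmx AR^T) 0 i) => x.
  have k2x : 0 < k ^+ 2 + (m%:R * x) ^+ 2 by rewrite ltr_wpDr ?sqr_ge0// exprn_gt0.
  have -> : (k / m%:R) ^+ 2 + x ^+ 2 = (k ^+ 2 + (m%:R * x) ^+ 2) / m%:R ^+ 2.
    by field; rewrite gt_eqF.
  by rewrite !mul1r invf_div.
have expE (z : 'rV[int]_n) :
    \prod_i expR (- (2 * pi * (k / m%:R))) ^+ `|(z *m A) 0 i| =
    \prod_i expR (- (2 * pi * k * `|(map_mx intr z *m C) 0 i|)) :> R.
  apply: eq_bigr => i _; rewrite -expRM_natl; congr expR.
  have -> : (map_mx intr z *m C) 0 i = m%:R^-1 * ((z *m A) 0 i)%:~R.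
    by rewrite /C -scalemxAr mxE -map_mxM; congr (_ * _); rewrite mxE.
  rewrite normrM normfV (gtr0_norm mR0).
  by rewrite natr_absz intr_norm; field; rewrite gt_eqF.
rewrite (eq_esum (fun z _ => congr1 EFin (scaleE z))) in H.
rewrite (eq_esum (b := fun z => _) (fun z _ => congr1 EFin (expE z))) in H.
rewrite esumZl// in H.
have dA : 0 < `|\det A|%N%:R :> R by rewrite ltr0n absz_gt0.
have pk : 0 < pi / k :> R by rewrite divr_gt0// pi_gt0.
rewrite esumZl; last first.
  by rewrite detC mulr_gt0// ?exprn_gt0// divr_gt0// exprn_gt0.
have := congr1 (fun x => ((m%:R ^+ 2) ^+ n)^-1%:E * x)%E H.
rewrite !muleA -!EFinM mulVf ?gt_eqF// mul1e => ->.
congr (_%:E * _)%E; rewrite detC.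
have -> : pi / (k / m%:R) = pi / k * m%:R by rewrite invf_div mulrA mulrAC.
rewrite -exprM mul2n -addnn exprD exprMn.
have : m%:R ^+ n != 0 :> R by rewrite expf_neq0// gt_eqF.
move: (m%:R ^+ n) (`|\det A|%N%:R : R) ((pi / k) ^+ n) => x y w x0.
by field.
Qed.

Lemma inv_sqr_dominated (k t : R) : 0 < k ->
  0 <= 1 / (k ^+ 2 + t ^+ 2) <= (1 / k ^+ 2 + 1) * (1 / (1 + t ^+ 2)).
Proof.
move=> k0; have k2 : 0 < k ^+ 2 by rewrite exprn_gt0.
have t2 := sqr_ge0 t; rewrite divr_ge0/=; [|by []|lra].
rewrite mulrA mulr1 ler_pdivrMr; last lra.
rewrite mulrAC ler_pdivlMr ?mul1r; last lra.
have -> : (k ^- 2 + 1) * (k ^+ 2 + t ^+ 2) = 1 + k ^- 2 * t ^+ 2 + k ^+ 2 + t ^+ 2.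
  by field; rewrite gt_eqF.
have : 0 <= k ^- 2 * t ^+ 2 by rewrite mulr_ge0// invr_ge0 ltW.
lra.
Qed.

(** From exp u >= 1 + u^2 / 2 with u = k |t|. This weak bound gives the exponential side the same
    majorant as the rational one. *)
Lemma expR_dominated (k t : R) : 0 < k ->
  0 <= expR (- (k * `|t|)) <= (1 + 2 / k ^+ 2) * (1 / (1 + t ^+ 2)).
Proof.
move=> k0; have k2 : 0 < k ^+ 2 by rewrite exprn_gt0.
have t2 := sqr_ge0 t; rewrite expR_ge0/= expRN.
rewrite mulrA mulr1 ler_pdivlMr; last lra.
rewrite [leLHS]mulrC ler_pdivrMr ?expR_gt0//.
have u0 : 0 <= k * `|t| by rewrite mulr_ge0// ltW.
have := expR_ge1Dxn 1 u0.
rewrite exprMn real_normK ?num_real// (_ : 2`! = 2)%N// => h.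
have c0 : 0 <= 1 + 2 / k ^+ 2 by rewrite addr_ge0// divr_ge0// ltW.
apply: le_trans (ler_wpM2l c0 h).
rewrite (_ : (1 + _) * _ = 1 + 2 / k ^+ 2 + k ^+ 2 * t ^+ 2 / 2 + t ^+ 2); last first.
  by field; rewrite gt_eqF.
have : 0 <= 2 / k ^+ 2 by rewrite divr_ge0// ltW.
have : 0 <= k ^+ 2 * t ^+ 2 / 2 by rewrite divr_ge0// mulr_ge0// ltW.
lra.
Qed.

(** The constant stands inside the second sum because its determinant changes along the
    approximation: the weights converge together with the terms. *)
Lemma poisson_lattice (C : 'M[R]_n) (k : R) : C \in unitmx -> 0 < k ->
  (\esum_(z in [set: 'rV[int]_n])
     (\prod_i (1 / (k ^+ 2 + (map_mx intr z *m invmx C^T) 0 i ^+ 2)))%:E)%E =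
  (\esum_(z in [set: 'rV[int]_n]) (`|\det C| * (pi / k) ^+ n *
     \prod_i expR (- (2 * pi * k * `|(map_mx intr z *m C) 0 i|)))%:E)%E.
Proof.
move=> Cu k0.
pose A N : 'M[int]_n := \matrix_(i, j) Num.floor (N.+1%:R * C i j).
pose CN N : 'M[R]_n := N.+1%:R^-1 *: map_mx intr (A N).
have CC : mx_cvg CN C.
  move=> i j; have := @mx_cvg_floor R n n C i j; apply: cvg_trans; apply: near_eq_cvg.
  by apply: nearW => N; rewrite !mxE mulrC.
have CTu : C^T \in unitmx by rewrite unitmx_tr.
have BB : mx_cvg (fun N => invmx (CN N)^T) (invmx C^T).
  by apply: mx_cvg_inv => //; exact: mx_cvg_tr.
have Bu : invmx C^T \in unitmx by rewrite unitmx_inv.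
pose a N (z : 'rV[int]_n) : R :=
  \prod_i (1 / (k ^+ 2 + (map_mx intr z *m invmx (CN N)^T) 0 i ^+ 2)).
pose w N : R := `|\det (CN N)| * (pi / k) ^+ n.
pose b N (z : 'rV[int]_n) : R :=
  w N * \prod_i expR (- (2 * pi * k * `|(map_mx intr z *m CN N) 0 i|)).
have w0 N : 0 <= w N by rewrite mulr_ge0// exprn_ge0// divr_ge0 ?pi_ge0// ltW.
have ww : w @ \oo --> `|\det C| * (pi / k) ^+ n.
  apply: cvgM; last exact: cvg_cst.
  by apply: cvg_norm; exact: mx_cvg_det.
have ca z : (fun N => a N z) @ \oo -->
    \prod_i (1 / (k ^+ 2 + (map_mx intr z *m invmx C^T) 0 i ^+ 2)).
  apply: cvg_prod_seq => i; have xi := @mx_cvg_mull R _ _ (map_mx intr z) _ _ BB 0 i.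
  apply: cvgM; first exact: cvg_cst.
  apply: cvgV; first by rewrite gt_eqF// ltr_wpDr ?sqr_ge0// exprn_gt0.
  apply: cvgD; first exact: cvg_cst.
  exact: (continuous_cvg _ (@exprn_continuous R 2 _)).
have cb z : (fun N => b N z) @ \oo --> `|\det C| * (pi / k) ^+ n *
    \prod_i expR (- (2 * pi * k * `|(map_mx intr z *m C) 0 i|)).
  apply: cvgM => //; apply: cvg_prod_seq => i.
  have xi := @mx_cvg_mull R _ _ (map_mx intr z) _ _ CC 0 i.
  apply: (continuous_cvg _ (@continuous_expR R _)).
  apply: cvgN; apply: cvgM; first exact: cvg_cst.
  exact: cvg_norm.
have ta : tight a.
  have c1 : (fun=> 1 : R) @ \oo --> (1 : R) by exact: cvg_cst.
  have -> : a = fun N z => 1 * a N z.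
    by apply/funext => N; apply/funext => z; rewrite mul1r.
  exact: tight_lattice BB Bu (fun t => inv_sqr_dominated t k0) c1 (fun=> ler01).
have pk : 0 < 2 * pi * k by rewrite mulr_gt0// mulr_gt0// pi_gt0.
have tb : tight b := tight_lattice CC Cu (fun t => expR_dominated t pk) ww w0.
have ab : \forall N \near \oo, (\esum_(z in [set: 'rV[int]_n]) (a N z)%:E =
    \esum_(z in [set: 'rV[int]_n]) (b N z)%:E)%E.
  have Nu := mx_cvg_unit CC Cu; near=> N.
  have : CN N \in unitmx by near: N.
  rewrite unitmxE unitfE detZ det_map_mx mulf_eq0 negb_or intr_eq0 => /andP[_ A0].
  exact: poisson_rational_lattice.
apply/le_anti/andP; split.
- apply: (esum_cvg_le ca cb tb).
  by apply: filterS ab => N ->.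
- apply: (esum_cvg_le cb ca ta).
  by apply: filterS ab => N ->.
Unshelve. all: by end_near.
Qed.

End PoissonLattice.

(** * Generator matrices, dual lattices and summability *)

Section LatticeSums.
Variables (R : realType) (n : nat).

Lemma mulmx_intr_inj (B : 'M[R]_n) : B \in unitmx ->
  injective (fun z : 'rV[int]_n => map_mx intr z *m B).
Proof.
move=> Bu z z' /(congr1 (mulmx^~ (invmx B))); rewrite -!mulmxA mulmxV// !mulmx1.
by move=> /rowP zz; apply/rowP => i; have := zz i; rewrite !mxE => /intr_inj.
Qed.

Lemma esum_generator_matrix (B : 'M[R]_n) (L : set 'rV[R]_n) (f : 'rV[R]_n -> \bar R) :
  generator_matrix B L ->
  (\esum_(x in L) f x = \esum_(z in [set: 'rV[int]_n]) f (map_mx intr z *m B))%E.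
Proof.
by move=> [Bu ->]; rewrite esum_image// => z z' _ _; exact: mulmx_intr_inj.
Qed.

(** Testing y against the rows of B shows that y B^T is an integer vector. *)
Lemma dual_generator_matrix (B : 'M[R]_n) (L : set 'rV[R]_n) :
  generator_matrix B L -> generator_matrix (invmx B^T) (dual L).
Proof.
move=> [Bu ->]; have BTu : B^T \in unitmx by rewrite unitmx_tr.
split; first by rewrite unitmx_inv.
have dotE (x y : 'rV[R]_n) : \sum_i x 0 i * y 0 i = (x *m y^T) 0 0.
  by rewrite mxE; apply: eq_bigr => i _; rewrite [y^T _ _]mxE.
apply/seteqP; split => [y yL|_ [w _ <-] _ [z _ <-]] /=.
  exists (\row_i Num.floor ((y *m B^T) 0 i)) => //.
  apply: (can_inj (mulmxK BTu)); rewrite -mulmxA mulVmx// mulmx1.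
  apply/rowP => i; rewrite !mxE; apply/floorK.
  have := yL (map_mx intr (delta_mx 0 i) *m B) (ex_intro2 _ _ _ I erefl).
  rewrite map_delta_mx -rowE; congr (_ \is a _).
  by apply: eq_bigr => j _; rewrite !mxE mulrC.
rewrite dotE trmx_mul trmx_inv trmxK mulmxA -(mulmxA (map_mx _ _)) mulmxV//.
by rewrite mulmx1 map_trmx -map_mxM mxE intr_int.
Qed.

(** Tightness of a constant sequence is summability. *)
Lemma esum_inv_sqr_lattice_lty (B : 'M[R]_n) (k : R) : B \in unitmx -> 0 < k ->
  (\esum_(z in [set: 'rV[int]_n])
     (\prod_i (1 / (k ^+ 2 + (map_mx intr z *m B) 0 i ^+ 2)))%:E < +oo)%E.
Proof.
move=> Bu k0.
have BB : mx_cvg (fun=> B) B by move=> i j; exact: cvg_cst.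
have c1 : (fun=> 1 : R) @ \oo --> (1 : R) by exact: cvg_cst.
have [s _ [N _ sN]] := tight_lattice BB Bu (fun t => inv_sqr_dominated t k0) c1
  (fun=> ler01) ltr01.
under eq_esum do rewrite -[X in X%:E]mul1r.
by apply: le_lt_trans (sN N (leqnn N)) _; exact: ltry.
Qed.

End LatticeSums.

Unset Implicit Arguments.
Set Strict Implicit.

Theorem proposition1 (R : realType) (n : nat) (s : R) (L : set 'rV[R]_n)
    (s_gt0 : 0 < s) (L_lattice : is_lattice L) :
  summable L (fun x : 'rV[R]_n => (\prod_(i < n) (1 / (1 + s * x 0 i ^+ 2)))%:E)
  /\
  (\esum_(x in L) (\prod_(i < n) (1 / (1 + s * x 0 i ^+ 2))%R)%:E
   = (1 / vol L * (pi / Num.sqrt s) ^+ n)%:E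
     * theta1 (dual L) (expR (- (2 * pi / Num.sqrt s))))%E.
Proof.
have [B BL] := L_lattice; have [Bu _] := BL.
have detB : \det B != 0 by move: Bu; rewrite unitmxE unitfE.
(* With this k, 1 + s x^2 = (k^2 + x^2) / k^2. *)
pose k := (Num.sqrt s)^-1.
have k0 : 0 < k by rewrite invr_gt0 sqrtr_gt0.
have sk : s = k ^- 2 by rewrite /k exprVn invrK sqr_sqrtr// ltW.
have k2n : 0 < (k ^+ 2) ^+ n by rewrite !exprn_gt0.
have termE (x : 'rV[R]_n) : \prod_(i < n) (1 / (1 + s * x 0 i ^+ 2)) =
    (k ^+ 2) ^+ n * \prod_i (1 / (k ^+ 2 + x 0 i ^+ 2)).
  transitivity (\prod_(i < n) (k ^+ 2 * (1 / (k ^+ 2 + x 0 i ^+ 2)))).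
    apply: eq_bigr => i _; rewrite sk.
    have kx : 0 < k ^+ 2 + x 0 i ^+ 2 by rewrite ltr_wpDr ?sqr_ge0// exprn_gt0.
    have -> : 1 + k ^- 2 * x 0 i ^+ 2 = (k ^+ 2 + x 0 i ^+ 2) / k ^+ 2.
      by field; rewrite gt_eqF.
    by rewrite !mul1r invf_div.
  by rewrite big_split/= prodr_const card_ord.
have sumE : (\esum_(x in L) (\prod_(i < n) (1 / (1 + s * x 0 i ^+ 2))%R)%:E =
    ((k ^+ 2) ^+ n)%:E * \esum_(z in [set: 'rV[int]_n])
     (\prod_i (1 / (k ^+ 2 + (map_mx intr z *m B) 0 i ^+ 2)))%:E)%E.
  rewrite (esum_generator_matrix _ BL) -esumZl//.
  by apply: eq_esum => z _; rewrite termE.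
split.
  rewrite /summable (eq_esum (b := fun x : 'rV[R]_n =>
    (\prod_(i < n) (1 / (1 + s * x 0 i ^+ 2))%R)%:E)); last first.
    move=> x _; rewrite abse_EFin ger0_norm// prodr_ge0// => i _.
    by rewrite divr_ge0// addr_ge0// mulr_ge0 ?sqr_ge0// ltW.
  rewrite sumE lte_mul_pinfty ?lee_fin ?(ltW k2n)//.
  exact: esum_inv_sqr_lattice_lty.
have CL := dual_generator_matrix BL.
(* [poisson_lattice] takes the generator of the exponential side, here the dual lattice; its other
   side then runs over [L]. *)
set C := invmx B^T in CL; have [Cu _] := CL.
have BE : B = invmx C^T by rewrite /C trmx_inv trmxK invmxK.
have pk : 0 < pi / k :> R by rewrite divr_gt0// pi_gt0.
rewrite sumE {1}BE poisson_lattice// esumZl; last first.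
  by rewrite mulr_gt0 ?exprn_gt0// normr_gt0 -unitfE -unitmxE.
rewrite muleA -EFinM (volE BL) /theta1 (esum_generator_matrix _ CL).
congr (_%:E * _)%E.
  (* The powers combine as k^(2 n) (pi / k)^n = (pi k)^n. *)
  rewrite /C det_inv det_tr normfV mulrCA -exprMn mul1r.
  congr (_ * _ ^+ n); rewrite -/k expr2; field; exact: lt0r_neq0.
apply: eq_esum => z _; congr (_%:E).
rewrite /l1norm -expRM -expR_sum.
congr expR; rewrite mulr_sumr; apply: eq_bigr => i _.
by rewrite mulNr -mulrA.
Qed.
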